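(* Let $Y_{t,T}=m(t/T)+\varepsilon_t$ for $1\le t\le T$, where $\{\varepsilon_t\}$ is a stationary and causal AR($p$) process $\varepsilon_t=\sum_{j=1}^pa_j\varepsilon_{t-j}+\eta_t$ of known order $p$ with i.i.d. innovations $\eta_t$, $\mathbb{E}[\eta_t]=0$, $\mathbb{E}[\eta_t^2]=\nu^2>0$. Suppose that the innovations $\eta_t$ have a finite fourth moment and that $m:[0,1]\to\mathbb{R}$ is Lipschitz continuous. Let $\boldsymbol a=(a_1,\dots,a_p)^\top$, let $\sigma^2=\sum_{\ell=-\infty}^\infty\mathrm{Cov}(\varepsilon_0,\varepsilon_\ell)$, and let $\widetilde{\boldsymbol a}_q$, $\widehat{\boldsymbol a}$ and $\widehat\sigma^2$ be the estimators defined in the context (with $\overline r\ge1$ a fixed natural number). If $q=q_T\to\infty$ with $q/\log T\to\infty$ and $q/\sqrt T\to0$, then, as $T\to\infty$, $$\widetilde{\boldsymbol a}_q-\boldsymbol a=O_p(T^{-1/2}),\qquad \widehat{\boldsymbol a}-\boldsymbol a=O_p(T^{-1/2}),\qquad \widehat\sigma^2-\sigma^2=O_p(T^{-1/2}).$$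
   Context: Causality means that $A(z)=1-\sum_{j=1}^pa_jz^j\neq 0$ for all complex $|z|\le1$, so that $\varepsilon_t=\sum_{k=0}^\infty c_k\eta_{t-k}$. The coefficients $c_k$ satisfy the recursion $c_k-\sum_{j=1}^pa_jc_{k-j}=b_k$ for $k=0,1,2,\dots$, with $b_0=1$, $b_k=0$ for $k>0$, and $c_k=0$ for $k<0$. Lipschitz continuity: $|m(u)-m(v)|\le C|u-v|$ for all $u,v\in[0,1]$ and some $C<\infty$. Differences: $\Delta_\ell Z_t=Z_t-Z_{t-\ell}$. For an integer $q\ge1$ (either $q=q_T$ or a fixed order $r$) and $\ell\ge0$ let $$\widehat\gamma_q(\ell)=\frac1{T-q}\sum_{t=q+\ell+1}^T\Delta_qY_{t,T}\,\Delta_qY_{t-\ell,T},\qquad \widehat\gamma_q(-\ell)=\widehat\gamma_q(\ell),$$ $\widehat{\boldsymbol\Gamma}_q=(\widehat\gamma_q(i-j):1\le i,j\le p)$ and $\widehat{\boldsymbol\gamma}_q=(\widehat\gamma_q(1),\dots,\widehat\gamma_q(p))^\top$. Pilot estimator: $\widetilde{\boldsymbol a}_q=(\widetilde a_1,\dots,\widetilde a_p)^\top=\widehat{\boldsymbol\Gamma}_q^{-1}\widehat{\boldsymbol\gamma}_q$ with $q=q_T$. Second step: let $\widetilde c_k$ be obtained from the recursion above with $a_1,\dots,a_p$ replaced by $\widetilde a_1,\dots,\widetilde a_p$, and set $\widetilde{\boldsymbol c}_r=(\widetilde c_{r-1},\dots,\widetilde c_{r-p})^\top$ for $r\ge1$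 (with $\widetilde c_k=0$ for $k<0$). Let $\widetilde\nu^2=(2T)^{-1}\sum_{t=p+2}^T\widetilde r_{t,T}^2$ with $\widetilde r_{t,T}=\Delta_1Y_{t,T}-\sum_{j=1}^p\widetilde a_j\Delta_1Y_{t-j,T}$. For fixed $r\ge1$ let $\widehat{\boldsymbol a}_r=\widehat{\boldsymbol\Gamma}_r^{-1}(\widehat{\boldsymbol\gamma}_r+\widetilde\nu^2\widetilde{\boldsymbol c}_r)$, and $$\widehat{\boldsymbol a}=(\widehat a_1,\dots,\widehat a_p)^\top=\frac1{\overline r}\sum_{r=1}^{\overline r}\widehat{\boldsymbol a}_r .$$ Long-run variance estimator: $\widehat\sigma^2=\widehat\nu^2/(1-\sum_{j=1}^p\widehat a_j)^2$ with $\widehat\nu^2=(2T)^{-1}\sum_{t=p+2}^T\widehat r_{t,T}^2$ and $\widehat r_{t,T}=\Delta_1Y_{t,T}-\sum_{j=1}^p\widehat a_j\Delta_1Y_{t-j,T}$. *)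

(* Defs.v *)
From mathcomp Require Export all_boot all_order all_algebra.
From mathcomp Require Export complex.
From mathcomp Require Import zify.
From mathcomp Require Export all_classical all_reals all_analysis.
Set Implicit Arguments.
Unset Strict Implicit.
Unset Printing Implicit Defensive.
Import Order.TTheory GRing.Theory Num.Theory.
Import numFieldNormedType.Exports.
Local Open Scope classical_set_scope.
Local Open Scope complex_scope.
Local Open Scope ring_scope.

Section probability_notions.
Context {d : measure_display} {Omega : measurableType d} {R : realType}.
Variable P : probability Omega R.

Definition mutually_independent (I : eqType) (X : I -> {RV P >-> R}) : Prop :=
  forall (J : seq I) (B : I -> set R), uniq J ->
    (forall i, measurable (B i)) ->
    P (\bigcap_(i in [set` J]) (X i @^-1` B i)) =
    (\prod_(i <- J) P (X i @^-1` B i))%E.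

Definition identically_distributed (I : Type) (X : I -> {RV P >-> R}) : Prop :=
  forall (s t : I) (B : set R), measurable B ->
    distribution P (X s) B = distribution P (X t) B.

Definition iid (I : eqType) (X : I -> {RV P >-> R}) : Prop :=
  mutually_independent X /\ identically_distributed X.

(* Second-order (weak) stationarity. *)
Definition stationary (X : int -> {RV P >-> R}) : Prop :=
  [/\ forall t, ('E_P[(fun w => X t w ^+ 2)%R] < +oo)%E,
      forall s t, ('E_P[X s] = 'E_P[X t])%E
    & forall s t h, covariance P (X (s + h)) (X (t + h)) =
                    covariance P (X s) (X t)].

(* The equation holds almost surely, for each t. *)
Definition ar_equation (p : nat) (a : 'cV[R]_p)
    (eps eta : int -> {RV P >-> R}) : Prop :=
  forall t : int, {ae P, forall w,
    eps t w = \sum_(j < p) a j 0 * eps (t - j.+1%:Z) w + eta t w}.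

(* Two-sided series: sum over l >= 0 plus sum over l < 0. *)
Definition long_run_variance (X : int -> {RV P >-> R}) : R :=
  let g (l : int) : R := fine (covariance P (X 0) (X l)) in
  limn (series (fun l : nat => g l%:Z)) +
  limn (series (fun l : nat => g (- l.+1%:Z))).

(* X n = O_p(b n): X n / b n is bounded in probability, for b n > 0. *)
Definition bigO_p (V : normedModType R) (X : nat -> Omega -> V)
    (b : nat -> R) : Prop :=
  forall e : R, 0 < e -> exists2 M : R, 0 < M &
    \forall n \near \oo, (P [set w | (M * b n < `|X n w|)%R] < e%:E)%E.

End probability_notions.

Section ar_coefficients.
Context {R : realType} {p : nat}.
Implicit Type a : 'cV[R]_p.

(* The coefficient a_j, 1 <= j <= p, is the entry of index j - 1 of a. *)
Definition causal a : Prop :=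
  forall z : R[i], `|z| <= 1 -> 1 - \sum_(j < p) (a j 0)%:C * z ^+ j.+1 != 0.

(* [:: c_k; ...; c_0] *)
Fixpoint ma_history a (k : nat) : seq R :=
  if k is k'.+1 then
    let h := ma_history a k' in (\sum_(j < p) a j 0 * nth 0 h j) :: h
  else [:: 1].

Definition ma_coef a (k : int) : R :=
  if k is Posz n then head 0 (ma_history a n) else 0.

Lemma nth_ma_history a (n j : nat) :
  nth 0 (ma_history a n) j = ma_coef a (n%:Z - j%:Z).
Proof.
have c_neg k : ma_coef a (0%:Z - k.+1%:Z) = 0.
  by have -> : 0%:Z - k.+1%:Z = Negz k by lia.
elim: n j => [|n IH] [|j]; rewrite ?subr0 ?c_neg ?[LHS]nth_nil //.
by rewrite [LHS]IH; congr ma_coef; lia.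
Qed.

(* The defining recursion, with b_0 = 1 and b_k = 0 for k > 0. *)
Lemma ma_coef_rec a (k : nat) :
  ma_coef a k%:Z - \sum_(j < p) a j 0 * ma_coef a (k%:Z - j.+1%:Z) =
  if k == 0%N then 1 else 0.
Proof.
case: k => [|k].
  by rewrite big1 ?subr0 // => j _; rewrite -nth_ma_history [nth _ _ _]nth_nil mulr0.
apply/eqP; rewrite subr_eq0; apply/eqP; apply: eq_bigr => j _.
by rewrite nth_ma_history; congr (_ * ma_coef _ _); lia.
Qed.

End ar_coefficients.

(* The data of sample size T are y 1, ..., y T; other values of y are unused.
   Where a sample matrix is singular or a denominator vanishes, the estimators
   take the default values of invmx and of division. *)
Section estimators.
Context {R : realType}.
Variables (p T : nat) (y : nat -> R).

(* Used only for t > l, where the truncated subtraction is exact. *)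
Definition lag_diff (l t : nat) : R := y t - y (t - l)%N.

Definition autocov_hat_nat (q l : nat) : R :=
  (T%:R - q%:R)^-1 *
  \sum_(q + l + 1 <= t < T.+1) lag_diff q t * lag_diff q (t - l)%N.

Definition autocov_hat (q : nat) (l : int) : R := autocov_hat_nat q `|l|%N.

Definition Gamma_hat (q : nat) : 'M[R]_p :=
  \matrix_(i, j) autocov_hat q (i%:Z - j%:Z).

Definition gamma_hat (q : nat) : 'cV[R]_p := \col_i autocov_hat q i.+1%:Z.

Definition a_pilot (q : nat) : 'cV[R]_p := invmx (Gamma_hat q) *m gamma_hat q.

Definition residual (b : 'cV[R]_p) (t : nat) : R :=
  lag_diff 1 t - \sum_(j < p) b j 0 * lag_diff 1 (t - j.+1)%N.

Definition innov_var (b : 'cV[R]_p) : R :=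
  (2 * T%:R)^-1 * \sum_(p + 2 <= t < T.+1) residual b t ^+ 2.

Definition ma_vec (b : 'cV[R]_p) (r : nat) : 'cV[R]_p :=
  \col_i ma_coef b (r%:Z - i.+1%:Z).

Definition a_second (q r : nat) : 'cV[R]_p :=
  invmx (Gamma_hat r) *m
  (gamma_hat r + innov_var (a_pilot q) *: ma_vec (a_pilot q) r).

Definition a_hat (q rbar : nat) : 'cV[R]_p :=
  rbar%:R^-1 *: \sum_(1 <= r < rbar.+1) a_second q r.

Definition sigma2_hat (q rbar : nat) : R :=
  innov_var (a_hat q rbar) / (1 - \sum_(j < p) a_hat q rbar j 0) ^+ 2.

End estimators.

(* Main.v *)
Require Import Defs.
From HB Require Import structures.
From mathcomp Require Import all_boot all_order all_algebra.
From mathcomp Require Import all_classical all_reals all_analysis.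
From mathcomp Require Import measurable_realfun ring lra zify.

(** The estimators are rational functions of finitely many sample
    autocovariances of differences of the data, so the whole statement reduces
    to two facts: these sample autocovariances are within O_p(T^(-1/2)) of
    deterministic limits, and at the limits the rational functions are regular
    and take the values a and sigma^2.

    The limits.  Write gamma for the autocovariance of eps, c for the
    moving-average coefficients and A for the autoregressive polynomial.  The
    autocovariance at lag l of the difference of order r is
    gamma_r(l) = 2 gamma(l) - gamma(l - r) - gamma(l + r)  ([diff_autocov]).
    Multiplying the autoregressive equation by eps_0 gives
    A gamma (h) = nu^2 c(-h) for every integer h, of either sign
    ([yule_walker]), and hence Gamma_r a = gamma_r + nu^2 c_r for r >= 1
    ([diff_yule_walker]): the second-step estimators solve the sample version
    of this system.  As r grows, gamma(l - r) and gamma(l + r) decay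
    exponentially, so that gamma_q is within O(T^(-1/2)) of 2 gamma as soon as
    q / log T tends to infinity, and 2 gamma solves the plain Yule-Walker
    system that defines the pilot estimator.  The matrices of these systems
    are Gram matrices of variables each of which involves an innovation that
    the later ones do not, hence they are invertible ([gram_unitmx]).  Summing
    the Yule-Walker equations over all integers gives
    sigma^2 = nu^2 / A(1)^2 ([two_sided_sum_autocov]).

    The rate.  What is needed is
    E|sum_(t < N) (eps_(s+t) eps_(s'+t) - gamma(s' - s))| <= K sqrt N
    with K independent of the two time shifts ([mean_norm_autocov_sum]), since
    one of the shifts grows with T.  After the substitution of the
    moving-average representation, truncated after n terms, the sum becomes a
    combination, with absolutely summable coefficients c_j c_k, of sums
    sum_t (eta_(t+x) eta_(t+y) - nu^2 [x = y]).  For fixed x and y the terms of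
    such a sum are orthogonal, so that its L^2 norm is of order sqrt N,
    uniformly in x and y; this is where the fourth moment enters.  The
    truncation error is exponentially small in n and disappears when n tends
    to infinity with N fixed.  The trend contributes O(q / T) to each
    difference, hence O(q) = O(sqrt T) to the sums ([mean_cross_sum]).

    Exponential decay.  All decay statements come from one fact: a sequence
    that satisfies the autoregressive recursion is annihilated by a polynomial
    in the shift whose complex roots have modulus less than 1, and the linear
    factors can be removed one at a time ([recursion_geometric]). *)

Import Order.TTheory GRing.Theory Num.Theory.
Import numFieldNormedType.Exports.
Local Open Scope classical_set_scope.
Local Open Scope ring_scope.
Set Implicit Arguments.
Unset Strict Implicit.
Unset Printing Implicit Defensive.

(** * Expectation of integrable and square-integrable functions *)

Section expectation.
Context {d : measure_display} {Omega : measurableType d} {R : realType}.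
Variable P : probability Omega R.
Implicit Types (f g : Omega -> R) (k : R).

Definition mean f : R := (\int[P]_w f w)%R.
Definition L1 f : Prop := P.-integrable setT (EFin \o f).
Definition L2 f : Prop := measurable_fun setT f /\ L1 (fun w => f w ^+ 2).

Lemma L1_measurable f : L1 f -> measurable_fun setT f.
Proof. by move=> /measurable_int /measurable_EFinP. Qed.

Lemma L1_le f g : measurable_fun setT f -> (forall w, `|f w| <= g w) ->
  L1 g -> L1 f.
Proof.
move=> mf fg ig; apply: (le_integrable measurableT _ _ ig).
  exact/measurable_EFinP.
by move=> w _ /=; rewrite lee_fin (le_trans (fg w)) ?ler_norm.
Qed.

Lemma L1_cst k : L1 (fun=> k).
Proof. exact: finite_measure_integrable_cst. Qed.

Lemma L1D f g : L1 f -> L1 g -> L1 (fun w => f w + g w).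
Proof. by move=> f1 g1; have := integrableD measurableT f1 g1. Qed.

Lemma L1Z k f : L1 f -> L1 (fun w => k * f w).
Proof. by move=> f1; have := integrableZl measurableT k f1. Qed.

Lemma L1N f : L1 f -> L1 (fun w => - f w).
Proof. by move=> f1; have := integrableN f1. Qed.

Lemma L1B f g : L1 f -> L1 g -> L1 (fun w => f w - g w).
Proof. by move=> f1 g1; apply: L1D => //; exact: L1N. Qed.

Lemma L1_norm f : L1 f -> L1 (fun w => `|f w|).
Proof. by move=> f1; have := integrable_abse f1. Qed.

Lemma L1_sum (I : Type) (s : seq I) (Q : pred I) (F : I -> Omega -> R) :
  (forall i, L1 (F i)) -> L1 (fun w => \sum_(i <- s | Q i) F i w).
Proof.
move=> F1; elim: s => [|i s IH].
  by under eq_fun do rewrite big_nil; exact: L1_cst.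
under eq_fun do rewrite big_cons.
by case: (Q i) => //; exact: L1D.
Qed.

Lemma meanD f g : L1 f -> L1 g ->
  mean (fun w => f w + g w) = mean f + mean g.
Proof. by move=> f1 g1; rewrite /mean RintegralD. Qed.

Lemma meanZ k f : L1 f -> mean (fun w => k * f w) = k * mean f.
Proof. by move=> f1; rewrite /mean RintegralZl. Qed.

Lemma meanB f g : L1 f -> L1 g ->
  mean (fun w => f w - g w) = mean f - mean g.
Proof. by move=> f1 g1; rewrite /mean RintegralB. Qed.

Lemma mean_cst k : mean (fun=> k) = k.
Proof.
rewrite /mean (Rintegral_cst P measurableT).
move: (@probability_setT _ _ _ P) => /= ->.
by rewrite mulr1.
Qed.

Lemma mean_sum (I : Type) (s : seq I) (Q : pred I) (F : I -> Omega -> R) :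
  (forall i, L1 (F i)) ->
  mean (fun w => \sum_(i <- s | Q i) F i w) = \sum_(i <- s | Q i) mean (F i).
Proof.
move=> F1; elim: s => [|i s IH].
  rewrite big_nil -[RHS](mean_cst 0); congr mean.
  by apply/funext => w; rewrite big_nil.
rewrite big_cons; under eq_fun do rewrite big_cons.
case: (Q i) => //; rewrite meanD ?IH //; exact: L1_sum.
Qed.

Lemma le_mean f g : L1 f -> L1 g -> (forall w, f w <= g w) ->
  mean f <= mean g.
Proof. by move=> f1 g1 fg; apply: le_Rintegral. Qed.

Lemma mean_ge0 f : (forall w, 0 <= f w) -> 0 <= mean f.
Proof. by move=> f0; apply: Rintegral_ge0. Qed.

Lemma normr_mean_le f : L1 f -> `|mean f| <= mean (fun w => `|f w|).
Proof. by move=> f1; apply: le_normr_Rintegral. Qed.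

Lemma mean_norm_sum (I : Type) (s : seq I) (Q : pred I) (F : I -> Omega -> R) :
  (forall i, L1 (F i)) ->
  mean (fun w => `|\sum_(i <- s | Q i) F i w|) <=
  \sum_(i <- s | Q i) mean (fun w => `|F i w|).
Proof.
move=> F1; rewrite -mean_sum; last by move=> i; exact: L1_norm.
apply: le_mean; [exact/L1_norm/L1_sum|apply: L1_sum => i; exact: L1_norm|].
by move=> w; exact: ler_norm_sum.
Qed.

Lemma mean_normD f g : L1 f -> L1 g ->
  mean (fun w => `|f w + g w|) <=
  mean (fun w => `|f w|) + mean (fun w => `|g w|).
Proof.
move=> f1 g1; rewrite -meanD ?L1_norm//; try exact: L1_norm.
apply: le_mean; [exact/L1_norm/L1D|by apply: L1D; exact: L1_norm|].
by move=> w; exact: ler_normD.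
Qed.

Lemma mean_normZ k f : L1 f ->
  mean (fun w => `|k * f w|) = `|k| * mean (fun w => `|f w|).
Proof.
move=> f1; rewrite -meanZ; last exact: L1_norm.
by under eq_fun do rewrite normrM.
Qed.

(** The weight l replaces the square roots of the Cauchy-Schwarz inequality;
    the bound is useful when l balances the two terms. *)
Lemma weighted_amgm (l x y : R) : 0 < l ->
  `|x * y| <= 2^-1 * (l * x ^+ 2 + l^-1 * y ^+ 2).
Proof.
move=> l0; rewrite normrM -(real_normK (num_real x)) -(real_normK (num_real y)).
move: `|x| `|y| => {}x {}y.
have -> : 2^-1 * (l * x ^+ 2 + l^-1 * y ^+ 2) =
  x * y + 2^-1 * l * (x - l^-1 * y) ^+ 2 by field; rewrite gt_eqF.
by rewrite lerDl mulr_ge0 ?sqr_ge0// mulr_ge0 ?ltW.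
Qed.

Lemma L2M f g : L2 f -> L2 g -> L1 (fun w => f w * g w).
Proof.
move=> [mf f2] [mg g2].
apply: (@L1_le _ (fun w => 2^-1 * (1 * f w ^+ 2 + 1^-1 * g w ^+ 2))).
- exact: measurable_funM.
- by move=> w; exact: weighted_amgm.
- by apply/L1Z/L1D; exact: L1Z.
Qed.

Lemma mean_normM_le l f g : 0 < l -> L2 f -> L2 g ->
  mean (fun w => `|f w * g w|) <=
  2^-1 * (l * mean (fun w => f w ^+ 2) + l^-1 * mean (fun w => g w ^+ 2)).
Proof.
move=> l0 f2 g2; have [[mf sf] [mg sg]] := (f2, g2).
rewrite -(meanZ l sf) -(meanZ l^-1 sg) -meanD; [|exact: L1Z..].
rewrite -meanZ; last by apply: L1D; exact: L1Z.
apply: le_mean; [exact/L1_norm/L2M|by apply/L1Z/L1D; exact: L1Z|].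
by move=> w; exact: weighted_amgm.
Qed.

Lemma L2_cst k : L2 (fun=> k).
Proof. by split; [exact: measurable_cst|exact: L1_cst]. Qed.

Lemma L2_L1 f : L2 f -> L1 f.
Proof.
move=> f2; have := L2M f2 (L2_cst 1).
by under eq_fun do rewrite mulr1.
Qed.

Lemma L2Z k f : L2 f -> L2 (fun w => k * f w).
Proof.
move=> [mf f2]; split; first exact: measurable_funM.
by under eq_fun do rewrite exprMn; exact: L1Z.
Qed.

Lemma L2D f g : L2 f -> L2 g -> L2 (fun w => f w + g w).
Proof.
move=> f2 g2; have [[mf sf] [mg sg]] := (f2, g2).
split; first exact: measurable_funD.
under eq_fun do rewrite sqrrD.
apply: L1D => //; apply: L1D => //.
under eq_fun do rewrite -mulr_natl.
exact/L1Z/L2M.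
Qed.

Lemma L2B f g : L2 f -> L2 g -> L2 (fun w => f w - g w).
Proof.
move=> f2 g2; have := L2D f2 (L2Z (-1) g2).
by under eq_fun do rewrite mulN1r.
Qed.

Lemma L2_sum (I : Type) (s : seq I) (Q : pred I) (F : I -> Omega -> R) :
  (forall i, L2 (F i)) -> L2 (fun w => \sum_(i <- s | Q i) F i w).
Proof.
move=> F1; elim: s => [|i s IH].
  by under eq_fun do rewrite big_nil; exact: L2_cst.
under eq_fun do rewrite big_cons.
by case: (Q i) => //; exact: L2D.
Qed.

(** The autoregressive equation holds only almost surely; this is the one way
    in which it enters expectations. *)
Lemma mean_ae f g : L1 f -> measurable_fun setT g ->
  {ae P, forall w, f w = g w} -> L1 g /\ mean f = mean g.
Proof.
move=> f1 mg fg; have mf := L1_measurable f1.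
split.
  apply/integrableP; split; first exact/measurable_EFinP.
  have /integrableP[_] := f1; congr (_ < _)%E.
  apply: ae_eq_integral => //.
  - by apply: measurableT_comp => //; exact/measurable_EFinP.
  - by apply: measurableT_comp => //; exact/measurable_EFinP.
  - by apply: filterS fg => w /= -> _.
congr fine; apply: ae_eq_integral => //; try exact/measurable_EFinP.
by apply: filterS fg => w /= -> _.
Qed.

Lemma EFin_mean_norm f : L1 f ->
  (\int[P]_w `|(f w)%:E|)%E = (mean (fun w => `|f w|))%:E.
Proof.
move=> f1; rewrite /mean /Rintegral fineK //.
exact/integrable_fin_num/L1_norm.
Qed.

Lemma measurable_norm_gt f (t : R) : measurable_fun setT f ->
  measurable [set w | t < `|f w|].
Proof.
move=> mf; have -> : [set w | t < `|f w|] =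
    setT `&` (Num.norm \o f) @^-1` `]t, +oo[%classic.
  by apply/seteqP; split=> w /=; rewrite in_itv/= andbT; [split|case].
by apply: measurableT_comp => //; exact: measurable_itv.
Qed.

Lemma markov_le f (t K : R) : 0 < t -> L1 f ->
  mean (fun w => `|f w|) <= K ->
  (P [set w | (t < `|f w|)%R] <= (K / t)%:E)%E.
Proof.
move=> t0 f1 fK; have mf := L1_measurable f1.
have := le_integral_abse P measurableT (measurable_int _ f1) t0.
rewrite EFin_mean_norm// => H.
rewrite mulrC EFinM lee_pdivlMl//.
apply: (@le_trans _ _ K%:E); last by [].
apply: le_trans (_ : ((mean (fun w => `|f w|))%:E <= _)%E); last by rewrite lee_fin.
apply: le_trans H; rewrite lee_pmul2l//; apply: le_measure.
- by rewrite inE; exact: measurable_norm_gt.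
- rewrite inE; apply: emeasurable_fun_c_infty => //.
  by apply: measurableT_comp => //; exact/measurable_EFinP.
- by move=> w /= tf; split=> //; rewrite lee_fin ltW.
Qed.

End expectation.

(** * Invertibility of Gram matrices *)

Section gram.
Context {d : measure_display} {Omega : measurableType d} {R : realType}.
Variable P : probability Omega R.

(** By the weighted bound, the absolute value of the expectation is at most
    E Z^2 / (2 l) for every l > 0. *)
Lemma mean_mul_eq0 (Q Z : Omega -> R) : L2 P Q -> L2 P Z ->
  mean P (fun w => Q w ^+ 2) = 0 -> mean P (fun w => Q w * Z w) = 0.
Proof.
move=> Q2 Z2 Q0; apply/eqP; rewrite -normr_le0; apply/ler_addgt0Pr => e e0.
set z := mean P (fun w => Z w ^+ 2).
have z0 : 0 <= z by apply: mean_ge0 => w; exact: sqr_ge0.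
have l0 : 0 < (z + 1) / e by rewrite divr_gt0// ltr_wpDl.
apply: le_trans (normr_mean_le (L2M Q2 Z2)) _.
apply: le_trans (mean_normM_le l0 Q2 Z2) _.
rewrite Q0 mulr0 add0r add0r -/z invf_div.
have : e / (z + 1) * z <= e.
  by rewrite mulrAC ler_pdivrMr ?ltr_wpDl// ler_pM2l// lerDl.
have : 0 <= e / (z + 1) * z by rewrite mulr_ge0// divr_ge0 ?ltW// ltr_wpDl.
lra.
Qed.

(** If v G = 0 then Q = sum_i v_i W_i has E Q^2 = 0, so Q is orthogonal to
    every Z_i.  Testing Q against Z_i, for the smallest i with v_i <> 0, leaves
    the single term v_i E(W_i Z_i), which is nonzero. *)
Lemma gram_unitmx (p : nat) (W Z : 'I_p -> Omega -> R) (G : 'M[R]_p) :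
  (forall i, L2 P (W i)) -> (forall i, L2 P (Z i)) ->
  (forall i j, G i j = mean P (fun w => W i w * W j w)) ->
  (forall i, mean P (fun w => W i w * Z i w) != 0) ->
  (forall i j : 'I_p, (i < j)%N -> mean P (fun w => W j w * Z i w) = 0) ->
  G \in unitmx.
Proof.
move=> W2 Z2 GE Wii Wij; rewrite unitmxE unitfE; apply/negP => /det0P[v v0 vG].
pose Q w := \sum_i v 0 i * W i w.
have Q2 : L2 P Q by apply: L2_sum => i; exact: L2Z.
have Q0 : mean P (fun w => Q w ^+ 2) = 0.
  have E w : Q w ^+ 2 = \sum_(j < p) \sum_(i < p) v 0 j * (v 0 i * (W i w * W j w)).
    rewrite expr2 mulr_sumr; apply: eq_bigr => j _.
    by rewrite mulr_suml; apply: eq_bigr => i _; ring.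
  have L1ij (i j : 'I_p) : L1 P (fun w => v 0 j * (v 0 i * (W i w * W j w))).
    by do 2 apply: L1Z; exact: L2M.
  under eq_fun do rewrite E.
  rewrite mean_sum; last by move=> j; exact: L1_sum.
  rewrite big1// => j _; rewrite mean_sum//.
  transitivity (v 0 j * (v *m G) 0 j); last by rewrite vG mxE mulr0.
  rewrite mxE mulr_sumr; apply: eq_bigr => i _.
  by rewrite GE meanZ ?meanZ//; [exact: L2M|apply: L1Z; exact: L2M].
have [k vk] : exists i, v 0 i != 0.
  by apply/existsP; apply: contra_neqT v0 => /existsPn H; apply/rowP => i;
     rewrite mxE; apply/eqP; rewrite -[_ == _]negbK H.
case: (@arg_minnP _ k (fun i => v 0 i != 0) (fun i => i : nat) vk) => i vi imin.
have := mean_mul_eq0 Q2 (Z2 i) Q0.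
under eq_fun do rewrite /Q mulr_suml.
have L1j (j : 'I_p) : L1 P (fun w => v 0 j * W j w * Z i w).
  by under eq_fun do rewrite -mulrA; apply: L1Z; exact: L2M.
rewrite mean_sum// (bigD1 i)//= big1 ?addr0 => [|j ji].
  under eq_fun do rewrite -mulrA.
  by rewrite meanZ; [move/eqP; rewrite mulf_eq0 (negPf vi) (negPf (Wii i))|exact: L2M].
under eq_fun do rewrite -mulrA.
rewrite meanZ; last exact: L2M.
have [ij|] := ltnP i j; first by rewrite Wij// mulr0.
rewrite leq_eqVlt (inj_eq val_inj) (negPf ji) /= => lt_ji.
have [->|vj] := eqVneq (v 0 j) 0; first by rewrite mul0r.
by have := imin j vj; rewrite leqNgt lt_ji.
Qed.

End gram.

(** * Independence of one variable from all the others *)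

Section independence.
Context {d : measure_display} {Omega : measurableType d} {R : realType}.
Variable P : probability Omega R.

(** The joint law of the pair agrees with the product of its marginals on
    rectangles, hence everywhere, and the formula is Fubini's theorem for the
    function (x, y) |-> x y. *)
Lemma mean_mul_indep (U W : {mfun Omega >-> R}) :
  (forall A B, measurable A -> measurable B ->
    P (U @^-1` A `&` W @^-1` B) = (P (U @^-1` A) * P (W @^-1` B))%E) ->
  L1 P U -> L1 P W -> L1 P (fun w => U w * W w) ->
  mean P (fun w => U w * W w) = mean P U * mean P W.
Proof.
move=> ind U1 W1 UW1.
pose UW : Omega -> R * R := fun w => (U w, W w).
have mUW : measurable_fun setT UW by exact: measurable_fun_pair.
pose HB := isMeasurableFun.Build _ _ _ _ UW mUW.
pose UWm : {mfun Omega >-> (R * R)%type} := HB.pack UW HB.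
pose m1 := distribution P U; pose m2 := distribution P W.
pose mm := distribution P UWm.
pose f (z : R * R) : \bar R := (z.1 * z.2)%:E.
have mf : measurable_fun setT f.
  by apply/measurable_EFinP; apply: measurable_funM.
have mE X : measurable X -> (m1 \x m2)%E X = mm X.
  by apply: product_measure_unique => A B mA mB; rewrite /mm /m1 /m2 -ind.
have if_mm : mm.-integrable setT f.
  by apply: integrable_pushforward.
have if_prod : (m1 \x m2)%E.-integrable setT f.
  apply/integrableP; split=> //.
  rewrite (eq_measure_integral mm); last by move=> A mA _; exact: mE.
  by have /integrableP[] := if_mm.
have idm (V : {mfun Omega >-> R}) : L1 P V ->
    (distribution P V).-integrable setT EFin /\
    (\int[distribution P V]_y y%:E)%E = (mean P V)%:E.
  move=> V1; have mE1 : measurable_fun setT (@EFin R) by exact/measurable_EFinP.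
  split; first exact: integrable_pushforward.
  rewrite integral_pushforward// preimage_setT /mean /Rintegral fineK//.
  exact: integrable_fin_num.
have [iU EU] := idm _ U1; have [iW EW] := idm _ W1.
have inner x : (\int[m2]_y f (x, y))%E = (x * mean P W)%:E.
  rewrite /f /=; under eq_integral do rewrite EFinM.
  by rewrite integralZl// EW.
apply: EFin_inj.
transitivity (\int[mm]_z f z)%E.
  rewrite integral_pushforward// preimage_setT /mean /Rintegral fineK//.
  exact: integrable_fin_num.
rewrite (eq_measure_integral (m1 \x m2)%E); last first.
  by move=> A mA _; apply: esym; exact: mE.
rewrite -integral12_prod_meas1//.
under eq_integral do rewrite /fubini_F inner EFinM muleC.
by rewrite integralZl// EU -EFinM mulrC.
Qed.

Section family.
Variables (I : choiceType) (X : I -> {RV P >-> R}).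
Hypothesis indX : mutually_independent X.

(** These events form a pi-system that generates the sigma-algebra of the
    family without X_i. *)
Definition cylinders_off (i : I) : set (set Omega) :=
  [set F | exists J : seq I, exists B : I -> set R,
    [/\ uniq J, i \notin J, forall j, measurable (B j) &
        F = \bigcap_(j in [set` J]) (X j @^-1` B j)]].

(** Measurability for the sigma-algebra generated by the variables other than
    X_i.  It is stable under all measurable operations, so that products of
    several variables need no separate treatment. *)
Definition measurable_off (i : I) (W : Omega -> R) : Prop :=
  measurable_fun [set: g_sigma_algebraType (cylinders_off i)] W.

Lemma cylinders_offI i : setI_closed (cylinders_off i).
Proof.
move=> _ _ [J [B [uJ iJ mB ->]]] [J' [B' [uJ' iJ' mB' ->]]].
pose C j := (if j \in J then B j else setT) `&` (if j \in J' then B' j else setT).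
exists (undup (J ++ J')), C; split.
- exact: undup_uniq.
- by rewrite mem_undup mem_cat negb_or iJ.
- by move=> j; apply: measurableI; case: ifP.
apply/seteqP; split=> w.
  move=> [H H'] j /=; rewrite mem_undup mem_cat => _; split.
    by case: ifP => // jJ; exact: H.
  by case: ifP => // jJ'; exact: H'.
move=> H; split=> j /= jJ.
  have /= := H j; rewrite mem_undup mem_cat jJ => /(_ isT) [+ _].
  by rewrite jJ.
have /= := H j; rewrite mem_undup mem_cat jJ orbT => /(_ isT) [_].
by rewrite jJ.
Qed.

Lemma measurable_cylinder (J : seq I) (B : I -> set R) :
  (forall j, measurable (B j)) ->
  measurable (\bigcap_(j in [set` J]) (X j @^-1` B j)).
Proof.
move=> mB; apply: fin_bigcap_measurable; first exact: finite_seq.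
by move=> j _; rewrite -[X in measurable X]setTI; exact: measurable_funPT.
Qed.

Lemma cylinders_off_setT i : cylinders_off i setT.
Proof.
exists [::], (fun=> setT); split=> //.
by apply/seteqP; split=> // w _ j; rewrite /= in_nil.
Qed.

Lemma indep_cylinder i A F : measurable A -> cylinders_off i F ->
  measurable F /\ P (X i @^-1` A `&` F) = (P (X i @^-1` A) * P F)%E.
Proof.
move=> mA [J [B [uJ iJ mB ->]]]; split; first exact: measurable_cylinder.
pose C j := if j == i then A else B j.
have mC j : measurable (C j) by rewrite /C; case: ifP.
have E1 : X i @^-1` A `&` \bigcap_(j in [set` J]) (X j @^-1` B j) =
    \bigcap_(j in [set` (i :: J)]) (X j @^-1` C j).
  apply/seteqP; split=> w.
    move=> [wA H] j /=; rewrite inE /C; case: eqP => [->|_ /=]; first by [].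
    exact: H.
  move=> H; split.
    by have /= := H i; rewrite mem_head /C eqxx; exact.
  move=> j /= jJ; have /= := H j; rewrite inE jJ orbT /C.
  by have [ji|] := eqVneq j i; [rewrite -ji jJ in iJ|move=> _; exact].
rewrite E1 !indX//=; last by rewrite iJ.
rewrite big_cons {1}/C eqxx; congr (_ * _)%E.
apply: eq_big_seq => j jJ; rewrite /C.
by have [ji|//] := eqVneq j i; rewrite -ji jJ in iJ.
Qed.

(** Dynkin's pi-lambda argument: the events S with the product property form
    a Dynkin system that contains the cylinders. *)
Lemma indep_sigma i A S : measurable A -> <<s cylinders_off i >> S ->
  measurable S /\ P (X i @^-1` A `&` S) = (P (X i @^-1` A) * P S)%E.
Proof.
move=> mA; have mXA : measurable (X i @^-1` A).
  by rewrite -[X in measurable X]setTI; exact: measurable_funPT.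
pose Q : set (set Omega) := [set S | measurable S /\
  P (X i @^-1` A `&` S) = (P (X i @^-1` A) * P S)%E].
have : @measurable _ (g_sigma_algebraType (cylinders_off i)) `<=` Q.
  apply: (@dynkin_induction _ (g_sigma_algebraType (cylinders_off i)) _ Q
    (erefl _) (@cylinders_offI i)).
  - exact/indep_cylinder/cylinders_off_setT.
  - by move=> F; exact: indep_cylinder.
  - move=> F _ [mF EF]; split; first exact: measurableC.
    rewrite -setDE measureD//; last by rewrite -ge0_fin_numE// fin_num_measure.
    transitivity (P (X i @^-1` A) - P (X i @^-1` A) * P F)%E.
      by congr (_ - _)%E.
    rewrite probability_setC// muleBr ?fin_num_measure// ?mule1//.
  - move=> F _ tF QF; have mF n : d.-measurable (F n) by case: (QF n).
    split; first exact: bigcupT_measurable.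
    rewrite setI_bigcupr measure_bigcup//; last 2 first.
    + by move=> n _; apply: measurableI.
    + exact: trivIset_setIl.
    rewrite measure_bigcup//.
    rewrite (eq_eseriesr (g := fun n => (P (X i @^-1` A) * P (F n))%E)); last first.
      by move=> n _; exact: (QF n).2.
    rewrite -(fineK (fin_num_measure P _ mXA)) nneseriesZl//.
by apply.
Qed.

Lemma measurable_offW i W : measurable_off i W -> measurable_fun setT W.
Proof.
move=> oW _ B mB; have := oW measurableT B mB; rewrite !setTI => H.
by have [] := indep_sigma measurableT H.
Qed.

Lemma measurable_off_proj i j : j != i -> measurable_off i (X j).
Proof.
move=> ji _ B mB; apply: sub_gen_smallest.
exists [:: j], (fun=> B); split=> //; first by rewrite inE eq_sym.
apply/seteqP; split=> w /=; first by move=> [_ ?] k /=; rewrite inE => /eqP ->.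
by move=> H; split=> //; apply: (H j); rewrite /= mem_head.
Qed.

Lemma mean_mul_off i (f : R -> R) (W : Omega -> R) :
  measurable_fun setT f -> measurable_off i W ->
  L1 P (fun w => f (X i w)) -> L1 P W -> L1 P (fun w => f (X i w) * W w) ->
  mean P (fun w => f (X i w) * W w) = mean P (fun w => f (X i w)) * mean P W.
Proof.
move=> mf oW f1 W1 fW1.
have mU : measurable_fun setT (f \o X i) by exact: measurableT_comp.
have mW := measurable_offW oW.
pose HU := isMeasurableFun.Build _ _ _ _ (f \o X i) mU.
pose U : {mfun Omega >-> R} := HB.pack (f \o X i) HU.
pose HW := isMeasurableFun.Build _ _ _ _ W mW.
pose V : {mfun Omega >-> R} := HB.pack W HW.
apply: (@mean_mul_indep U V) => // A B mA mB.
have mfA : measurable (f @^-1` A) by rewrite -[X in measurable X]setTI; exact: mf.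
have := oW measurableT B mB; rewrite setTI => H.
by have [] := indep_sigma mfA H.
Qed.

Lemma measurable_offM i W W' : measurable_off i W -> measurable_off i W' ->
  measurable_off i (fun w => W w * W' w).
Proof. by move=> oW oW'; exact: measurable_funM. Qed.

Lemma measurable_off_comp i W (f : R -> R) : measurable_off i W -> measurable_fun setT f ->
  measurable_off i (f \o W).
Proof. by move=> oW mf; exact: measurableT_comp. Qed.

End family.
End independence.

(** * Sums of products of innovations *)

Section innovations.
Context {d : measure_display} {Omega : measurableType d} {R : realType}.
Variable P : probability Omega R.
Variables (eta : int -> {RV P >-> R}) (nu : R).
Hypothesis eta_iid : iid eta.
Hypothesis eta_mean : forall t, ('E_P[eta t] = 0)%E.
Hypothesis eta_var :
  forall t, ('E_P[(fun w => eta t w ^+ 2)%R] = (nu ^+ 2)%:E)%E.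
Hypothesis eta_fourth :
  forall t, ('E_P[(fun w => eta t w ^+ 4)%R] < +oo)%E.

Lemma eta_measurable t : measurable_fun setT (eta t).
Proof. exact: measurable_funPT. Qed.
Hint Resolve eta_measurable : core.

Lemma L2_eta_sqr t : L2 P (fun w => eta t w ^+ 2).
Proof.
split; first exact: measurable_funX.
apply/integrableP; split.
  by apply/measurable_EFinP; do 2 apply: measurable_funX.
have := eta_fourth t; rewrite unlock; congr (_ < _)%E.
apply: eq_integral => w _ /=; rewrite ger0_norm -?exprM//.
by rewrite exprn_even_ge0.
Qed.

Lemma L2_eta t : L2 P (eta t).
Proof. by split=> //; apply: L2_L1; exact: L2_eta_sqr. Qed.

Lemma mean_eta t : mean P (eta t) = 0.
Proof. by have := eta_mean t; rewrite unlock /mean /Rintegral => ->. Qed.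

Lemma mean_eta_sqr t : mean P (fun w => eta t w ^+ 2) = nu ^+ 2.
Proof. by have := eta_var t; rewrite unlock /mean /Rintegral => ->. Qed.

(** Identical distribution is used only here, to bound the fourth moments
    uniformly in time. *)
Lemma mean_eta_fourth t : mean P (fun w => eta t w ^+ 4) =
  mean P (fun w => eta 0 w ^+ 4).
Proof.
rewrite /mean /Rintegral; congr fine.
have mf : measurable_fun [set: R] (fun x : R => (x ^+ 4)%:E).
  by apply/measurable_EFinP; exact: measurable_funX.
have i4 s : P.-integrable setT ((fun x : R => (x ^+ 4)%:E) \o eta s).
  have [_] := L2_eta_sqr s; rewrite /L1; congr (P.-integrable _ _).
  by apply/funext => w /=; rewrite -exprM.
have E s : (\int[P]_w (eta s w ^+ 4)%:E = \int[distribution P (eta s)]_x (x ^+ 4)%:E)%E.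
  by rewrite integral_pushforward.
rewrite !E; apply: eq_measure_integral => A mA _.
by have [_] := eta_iid; exact.
Qed.

Lemma L2_etaM s t : L2 P (fun w => eta s w * eta t w).
Proof.
split; first exact: measurable_funM.
under eq_fun do rewrite exprMn.
by apply: L2M; exact: L2_eta_sqr.
Qed.

Lemma mean_etaM s t :
  mean P (fun w => eta s w * eta t w) = nu ^+ 2 * (s == t)%:R.
Proof.
have [->|st] := eqVneq s t.
  by rewrite mulr1 -(mean_eta_sqr t); under eq_fun do rewrite -expr2.
have [ind _] := eta_iid.
rewrite (mean_mul_off ind (i := s) (f := id)) ?mean_eta ?mul0r ?mulr0//.
- by apply: measurable_off_proj => //; rewrite eq_sym.
- exact/L2_L1/L2_eta.
- exact/L2_L1/L2_eta.
- exact/L2_L1/L2_etaM.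
Qed.

Definition centred_prod (x y : int) (w : Omega) : R :=
  eta x w * eta y w - nu ^+ 2 * (x == y)%:R.

Lemma L2_centred_prod x y : L2 P (centred_prod x y).
Proof. by apply: L2B; [exact: L2_etaM|exact: L2_cst]. Qed.

Lemma centred_prodC x y : centred_prod x y = centred_prod y x.
Proof. by apply/funext => w; rewrite /centred_prod mulrC eq_sym. Qed.

(** For x <> y the largest of the four time indices occurs only once, at the
    later time s; the corresponding innovation is independent of the other
    three factors and has mean zero.  For x = y the two factors are functions
    of two distinct innovations, and each has mean zero. *)
Lemma centred_prod_orth (x y : int) (s t : nat) : (t < s)%N ->
  mean P (fun w => centred_prod (x + s%:Z) (y + s%:Z) w *
                   centred_prod (x + t%:Z) (y + t%:Z) w) = 0.
Proof.
move=> ts; have [ind _] := eta_iid.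
wlog yx : x y / (y <= x)%R.
  move=> H; have [/H//|/ltW/H yx] := leP y x.
  by rewrite centred_prodC (centred_prodC (x + t%:Z)).
move: yx; rewrite le_eqVlt => /predU1P[->|yx].
  rewrite (mean_mul_off ind (i := x + s%:Z)
    (f := fun u => u * u - nu ^+ 2 * (x + s%:Z == x + s%:Z)%:R)
    (W := centred_prod (x + t%:Z) (x + t%:Z))).
  - under eq_fun do rewrite -expr2.
    rewrite meanB ?mean_eta_sqr ?mean_cst ?eqxx ?mulr1 ?subrr ?mul0r//.
    + exact/L2_L1/L2_eta_sqr.
    + exact: L1_cst.
  - by apply: measurable_funB => //; exact: measurable_funM.
  - apply: (@measurable_off_comp _ _ _ P _ eta (x + s%:Z) (eta (x + t%:Z))
      (fun u => u * u - nu ^+ 2 * (x + t%:Z == x + t%:Z)%:R)).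
      by apply: measurable_off_proj; lia.
    by apply: measurable_funB => //; exact: measurable_funM.
  - by apply: L2_L1; exact: L2_centred_prod.
  - by apply: L2_L1; exact: L2_centred_prod.
  - by apply: L2M; exact: L2_centred_prod.
have E (u : nat) : centred_prod (x + u%:Z) (y + u%:Z) =
    fun w => eta (x + u%:Z) w * eta (y + u%:Z) w.
  apply/funext => w; rewrite /centred_prod (_ : _ == _ = false) ?mulr0 ?subr0//.
  by lia.
rewrite !E; under eq_fun do rewrite -mulrA.
rewrite (mean_mul_off ind (f := id)) ?mean_eta ?mul0r//.
- by do 2?[apply: measurable_offM]; apply: measurable_off_proj; lia.
- exact/L2_L1/L2_eta.
- by apply: L2M; [exact: L2_eta|exact: L2_etaM].
- under eq_fun do rewrite mulrA.
  by apply: L2M; exact: L2_etaM.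
Qed.

(** An upper bound for the second moment of [centred_prod x y] that depends
    neither on x nor on y. *)
Definition centred_prod_bound : R := 2 * mean P (fun w => eta 0 w ^+ 4) + 2 * nu ^+ 4.

Lemma centred_prod_bound_ge0 : 0 <= centred_prod_bound.
Proof.
rewrite addr_ge0// mulr_ge0//; last by rewrite exprn_even_ge0.
by apply: mean_ge0 => w; rewrite exprn_even_ge0.
Qed.

Lemma mean_centred_prod_sqr x y :
  mean P (fun w => centred_prod x y w ^+ 2) <= centred_prod_bound.
Proof.
have i4 s : L1 P (fun w => eta s w ^+ 4).
  by have [_] := L2_eta_sqr s; under eq_fun do rewrite -exprM.
apply: (@le_trans _ _ (mean P (fun w => eta x w ^+ 4 + eta y w ^+ 4 + 2 * nu ^+ 4))).
  apply: le_mean; [by have [] := L2_centred_prod x y| |].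
    by apply: L1D; [exact: L1D|exact: L1_cst].
  move=> w; rewrite /centred_prod.
  move: (eta x w) (eta y w) => u v.
  set b0 : R := (x == y)%:R.
  have b0_ge0 : 0 <= b0 by exact: ler0n.
  have b0_le1 : b0 <= 1 by rewrite /b0 (ler_nat R _ 1) leq_b1.
  have h1 : (u * v - nu ^+ 2 * b0) ^+ 2 <= 2 * (u * v) ^+ 2 + 2 * (nu ^+ 2 * b0) ^+ 2.
    have := sqr_ge0 (u * v + nu ^+ 2 * b0); nra.
  have h2 : 2 * (u * v) ^+ 2 <= u ^+ 4 + v ^+ 4.
    have := sqr_ge0 (u ^+ 2 - v ^+ 2); nra.
  have h3 : (nu ^+ 2 * b0) ^+ 2 <= nu ^+ 4.
    rewrite exprMn -exprM -[leRHS]mulr1 ler_wpM2l ?exprn_even_ge0//.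
    by rewrite expr_le1.
  lra.
rewrite meanD ?mean_cst; [|exact: L1D|exact: L1_cst].
rewrite meanD// !(mean_eta_fourth x) !(mean_eta_fourth y) /centred_prod_bound; lra.
Qed.

(** Pythagoras for an orthogonal sum. *)
Lemma mean_sum_centred_prod_sqr x y (N : nat) :
  mean P (fun w => (\sum_(t < N) centred_prod (x + t%:Z) (y + t%:Z) w) ^+ 2)
  <= N%:R * centred_prod_bound.
Proof.
elim: N => [|N IH].
  by under eq_fun do rewrite big_ord0 expr0n; rewrite mean_cst mul0r.
set S := fun w => \sum_(t < N) centred_prod (x + t%:Z) (y + t%:Z) w in IH.
set V := centred_prod (x + N%:Z) (y + N%:Z).
have L2S : L2 P S by apply: L2_sum => i; exact: L2_centred_prod.
have L2V : L2 P V by exact: L2_centred_prod.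
have -> : (fun w => (\sum_(t < N.+1) centred_prod (x + t%:Z) (y + t%:Z) w) ^+ 2)
    = fun w => S w ^+ 2 + 2 * (V w * S w) + V w ^+ 2.
  by apply/funext => w; rewrite big_ord_recr /= -/(S w) -/(V w); ring.
have [[_ S1] [_ V1]] := (L2S, L2V).
have VS1 : L1 P (fun w => V w * S w) by exact: L2M.
rewrite meanD//; last by apply: L1D => //; exact: L1Z.
rewrite meanD//; last exact: L1Z.
rewrite meanZ// [X in 2 * X](_ : _ = 0); last first.
  under eq_fun do rewrite /S mulr_sumr.
  rewrite mean_sum; last by move=> i; apply: L2M => //; exact: L2_centred_prod.
  by rewrite big1// => i _; apply: centred_prod_orth.
rewrite mulr0 addr0 -natr1 mulrDl mul1r lerD//.
exact: mean_centred_prod_sqr.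
Qed.

Lemma mean_norm_sum_centred_prod x y (N : nat) :
  mean P (fun w => `|\sum_(t < N) centred_prod (x + t%:Z) (y + t%:Z) w|)
  <= (centred_prod_bound + 1) * Num.sqrt N%:R.
Proof.
have [->|N0] := posnP N.
  by under eq_fun do rewrite big_ord0 normr0; rewrite mean_cst sqrtr0 mulr0.
pose S w := \sum_(t < N) centred_prod (x + t%:Z) (y + t%:Z) w.
have L2S : L2 P S by apply: L2_sum => i; exact: L2_centred_prod.
have s0 : 0 < Num.sqrt (N%:R : R) by rewrite sqrtr_gt0 ltr0n.
have sN : Num.sqrt (N%:R : R) ^+ 2 = N%:R by rewrite sqr_sqrtr.
(* This weight balances E S^2, of order N, against E 1 = 1. *)
have := mean_normM_le (l := (Num.sqrt N%:R)^-1) _ L2S (L2_cst P 1).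
rewrite invr_gt0 => /(_ s0).
under eq_fun do rewrite mulr1.
move=> /le_trans; apply.
have H := mean_sum_centred_prod_sqr x y N.
rewrite -/S in H; rewrite expr1n mean_cst invrK mulr1.
have : (Num.sqrt N%:R)^-1 * mean P (fun w => S w ^+ 2) <= Num.sqrt N%:R * centred_prod_bound.
  rewrite mulrC ler_pdivrMr// mulrAC -expr2 sN; exact: H.
have := centred_prod_bound_ge0; nra.
Qed.

End innovations.

(** * Exponential decay of solutions of a causal recursion *)

Local Open Scope complex_scope.

Section recursion_decay.
Context {R : realType}.
Local Notation C := R[i].

(** K' solves |lam| K' + K <= rho K', the inequality that carries the bound
    from n to n + 1; this needs |lam| < rho strictly, and then the rate rho is
    not degraded. *)
Lemma geometric_of_first_order (lam rho K : C) (y : nat -> C) :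
  `|lam| < rho -> (forall n, `|y n.+1 - lam * y n| <= K * rho ^+ n) ->
  exists K', forall n, `|y n| <= K' * rho ^+ n.
Proof.
move=> lr H.
have d0 : 0 < rho - `|lam| by rewrite subr_gt0.
have rho0 : 0 <= rho by exact: le_trans (normr_ge0 lam) (ltW lr).
have K0 : 0 <= K by have := le_trans (normr_ge0 _) (H 0%N); rewrite expr0 mulr1.
pose K' := `|y 0%N| + K / (rho - `|lam|).
exists K'; elim=> [|n IH].
  by rewrite expr0 mulr1 lerDl divr_ge0// ltW.
rewrite -[y n.+1](subrK (lam * y n)) (le_trans (ler_normD _ _))//.
apply: (@le_trans _ _ (K * rho ^+ n + `|lam| * (K' * rho ^+ n))).
  by rewrite lerD// normrM ler_wpM2l.
have -> : K * rho ^+ n + `|lam| * (K' * rho ^+ n) =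
  (K + `|lam| * K') * rho ^+ n by ring.
rewrite exprS mulrA ler_wpM2r ?exprn_ge0//.
have -> : K' * rho = K + `|lam| * K' + (rho - `|lam|) * `|y 0%N|.
  rewrite /K'; field; by rewrite gt_eqF.
by rewrite lerDl mulr_ge0// ltW.
Qed.

(** The action of a polynomial on sequences in which the variable acts as the
    shift n |-> n + 1. *)
Definition shift_apply (x : nat -> C) (n : nat) (q : {poly C}) : C :=
  \sum_(i < size q) q`_i * x (n + i)%N.

Lemma shift_applyE x n (q : {poly C}) N : (size q <= N)%N ->
  shift_apply x n q = \sum_(i < N) q`_i * x (n + i)%N.
Proof.
move=> qN; rewrite /shift_apply -!(big_mkord xpredT (fun i => q`_i * x (n + i)%N)).
rewrite [RHS](big_cat_nat (n := size q))//= -[LHS]addr0; congr (_ + _).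
rewrite big_nat_cond big1// => i /andP[/andP[qi _] _].
by rewrite nth_default ?mul0r.
Qed.

Lemma shift_apply_root x n (lam : C) (q : {poly C}) :
  shift_apply x n (('X - lam%:P) * q) =
  shift_apply x n.+1 q - lam * shift_apply x n q.
Proof.
have sN : (size (('X - lam%:P) * q)%R <= (size q).+1)%N.
  by rewrite (leq_trans (size_polyMleq _ _))// size_XsubC.
rewrite (shift_applyE _ _ sN) (@shift_applyE x n q (size q).+1)//.
rewrite mulr_sumr.
under eq_bigr do rewrite mulrBl coefB coefXM coefCM mulrBl.
rewrite sumrB big_ord_recl /= mul0r add0r; congr (_ - _).
  by apply: eq_bigr => i _; rewrite /bump /= add1n addSnnS.
by apply: eq_bigr => i _; rewrite mulrA.
Qed.

(** The linear factors are removed one by one; each removal is an instance of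
    [geometric_of_first_order] with the same rate. *)
Lemma geometric_of_roots (rho : C) (s : seq C) (x : nat -> C) :
  (forall lam, lam \in s -> `|lam| < rho) ->
  (forall n, shift_apply x n (\prod_(lam <- s) ('X - lam%:P)) = 0) ->
  exists K, forall n, `|x n| <= K * rho ^+ n.
Proof.
move=> sr H.
suff G t K : (forall lam, lam \in t -> `|lam| < rho) ->
    (forall n, `|shift_apply x n (\prod_(lam <- t) ('X - lam%:P))| <= K * rho ^+ n) ->
    exists K, forall n, `|x n| <= K * rho ^+ n.
  by apply: (G s 0) => // n; rewrite H normr0 mul0r.
elim: t K {s sr H} => [|lam t IH] K tr H.
  exists K => n; have := H n.
  by rewrite big_nil /shift_apply size_poly1 big_ord1 coef1 mul1r addn0.
have [K' HK'] : exists K', forall n,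
    `|shift_apply x n (\prod_(lam <- t) ('X - lam%:P))| <= K' * rho ^+ n.
  apply: (@geometric_of_first_order lam rho K
    (fun n => shift_apply x n (\prod_(lam <- t) ('X - lam%:P)))).
    by apply: tr; rewrite mem_head.
  by move=> n; have := H n; rewrite big_cons shift_apply_root.
by apply: (IH K') => // mu mt; apply: tr; rewrite inE mt orbT.
Qed.

Variables (p : nat) (a : 'cV[R]_p).

Lemma charpoly_split : exists s : seq C,
  'X^p - \sum_(j < p) (a j 0)%:C *: 'X^(p - j.+1) =
  \prod_(lam <- s) ('X - lam%:P).
Proof.
set chi := _ - _.
have sz : (size (\sum_(j < p) (a j 0)%:C *: 'X^(p - j.+1) : {poly C})%R < p.+1)%N.
  rewrite ltnS (leq_trans (size_sum _ _ _))//; apply/bigmax_leqP => j _.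
  rewrite (leq_trans (size_scale_leq _ _))// size_polyXn.
  by have := ltn_ord j; lia.
have [s Es] := closed_field_poly_normal chi.
exists s; rewrite {1}Es.
by rewrite /chi lead_coefDl ?size_polyN ?size_polyXn// lead_coefXn scale1r.
Qed.

(** The inverse of a root of modulus at least 1 would be a zero of the
    autoregressive polynomial in the closed unit disk. *)
Lemma causal_root (lam : C) : causal a ->
  root ('X^p - \sum_(j < p) (a j 0)%:C *: 'X^(p - j.+1)) lam -> `|lam| < 1.
Proof.
move=> ca; rewrite rootE !hornerE horner_sum => /eqP H.
have [//|] := real_ltP (normr_real lam) (real1 C).
move=> l1; have l0 : lam != 0.
  by apply: contraTneq l1 => ->; rewrite normr0 ler10.
have := ca lam^-1; rewrite normfV invf_le1 ?normr_gt0// => /(_ l1) /negP[].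
suff : lam ^+ p * (1 - \sum_(j < p) (a j 0)%:C * lam^-1 ^+ j.+1) = 0.
  by move=> /eqP; rewrite mulf_eq0 expf_eq0 (negPf l0) andbF.
rewrite -[RHS]H mulrBr mulr1 mulr_sumr; congr (_ - _).
apply: eq_bigr => j _; rewrite hornerZ hornerXn mulrCA; congr (_ * _).
by rewrite exprVn -expfB_cond// (negPf l0) add0n.
Qed.

Lemma uniform_modulus_bound (s : seq C) :
  (forall lam, lam \in s -> `|lam| < 1) ->
  exists rho : R, 0 < rho < 1 /\ forall lam, lam \in s -> `|lam| < rho%:C.
Proof.
elim: s => [|lam s IH] H; first by exists 2^-1; split=> //; lra.
have [mu ms|rho [/andP[r0 r1] Hr]] := IH; first by apply: H; rewrite inE ms orbT.
have := H lam (mem_head _ _); rewrite normc_def -[1]/(1%:C) ltcR.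
set r := Num.sqrt _ => l1.
exists (Num.max rho ((1 + r) / 2)); split.
  rewrite lt_max r0 /= gt_max r1 /=; lra.
move=> mu; rewrite inE => /predU1P[->|ms].
  by rewrite normc_def ltcR -/r lt_max; apply/orP; right; lra.
by apply: lt_le_trans (Hr _ ms) _; rewrite lecR le_max lexx.
Qed.

(** The rate depends on the coefficients only, and serves all solutions. *)
Lemma recursion_geometric : causal a ->
  exists rho : R, 0 < rho < 1 /\ forall x : nat -> R,
    (forall n, x (n + p)%N = \sum_(j < p) a j 0 * x (n + p - j.+1)%N) ->
    exists K, forall n, `|x n| <= K * rho ^+ n.
Proof.
move=> ca; have [s Es] := charpoly_split.
have [lam ls|rho [r01 Hrho]] := @uniform_modulus_bound s.
  by apply: causal_root => //; rewrite Es root_prod_XsubC.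
exists rho; split=> // x Hx.
have [lam|n|K HK] := @geometric_of_roots rho%:C s (fun n => (x n)%:C); first exact: Hrho.
  rewrite -Es; set q := (X in shift_apply _ _ X).
  have sq : (size q <= p.+1)%N.
    rewrite /q (leq_trans (size_polyD _ _))// geq_max size_polyXn leqnn size_polyN.
    rewrite (leq_trans (size_sum _ _ _))//; apply/bigmax_leqP => j _.
    by rewrite (leq_trans (size_scale_leq _ _))// size_polyXn; have := ltn_ord j; lia.
  rewrite (shift_applyE _ _ sq) /q.
  under eq_bigr do rewrite coefB coefXn coef_sum mulrBl.
  rewrite sumrB big_ord_recr /= eqxx mul1r big1 ?add0r; last first.
    by move=> i _; rewrite (ltn_eqF (ltn_ord i)) mul0r.
  apply/eqP; rewrite subr_eq0 Hx rmorph_sum /=; apply/eqP.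
  under [RHS]eq_bigr do rewrite mulr_suml.
  rewrite exchange_big /=; apply: eq_bigr => j _.
  have jp : (p - j.+1 < p.+1)%N by lia.
  rewrite (bigD1 (Ordinal jp))//= coefZ coefXn eqxx mulr1 big1 ?addr0.
    by rewrite rmorphM /= addnBA.
  move=> i /eqP ij; rewrite coefZ coefXn; case: eqP => [e|]; last by rewrite mulr0 mul0r.
  by exfalso; apply: ij; apply/val_inj.
have K0 : 0 <= K.
  by have := le_trans (normr_ge0 _) (HK 0%N); rewrite expr0 mulr1.
exists (complex.Re K) => n; have := HK n.
have /RRe_real <- : K \is Num.real by rewrite ger0_real.
rewrite normc_def /= expr0n addr0 sqrtr_sqr -rmorphXn -rmorphM lecR.
exact.
Qed.

End recursion_decay.

(** * Moving-average coefficients *)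

Section decay_corollaries.
Context {R : realType}.
Variables (p : nat) (a : 'cV[R]_p).

(** The form in which truncation errors disappear: x is fixed and the bound
    holds for every large truncation order n. *)
Lemma geometric_le0 (rho x C : R) (N : nat) : 0 < rho < 1 ->
  (forall n, (N <= n)%N -> x <= C * rho ^+ n) -> x <= 0.
Proof.
move=> /andP[r0 r1] H.
have cv : (C * rho ^+ n) @[n --> \oo] --> C * 0.
  by apply: cvgM; [exact: cvg_cst|apply: cvg_expr; rewrite gtr0_norm].
rewrite mulr0 in cv; rewrite -(cvg_lim _ cv)//.
apply: limr_ge; first by apply/cvg_ex; exists 0.
by near=> n; apply: H; near: n; exact: nbhs_infty_ge.
Unshelve. all: by end_near. Qed.

(** The recursion is required at positive times only, so that its solutions
    include the moving-average coefficients, which violate it at time 0. *)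
Lemma int_recursion_geometric : causal a -> exists rho : R, 0 < rho < 1 /\
  forall f : int -> R,
    (forall h : nat, f h.+1%:Z = \sum_(j < p) a j 0 * f (h.+1%:Z - j.+1%:Z)) ->
    exists2 K, 0 <= K & forall h : nat, `|f h%:Z| <= K * rho ^+ h.
Proof.
move=> /recursion_geometric[rho [r01 H]]; have /andP[r0 r1] := r01.
exists rho; split=> // f Hf.
have [n|K HK] := H (fun n => f n.+1%:Z).
  rewrite Hf; apply: eq_bigr => j _; congr (_ * f _).
  by have := ltn_ord j; lia.
have K0 : 0 <= K by have := le_trans (normr_ge0 _) (HK 0%N); rewrite expr0 mulr1.
exists (`|f 0| + K / rho); first by rewrite addr_ge0// divr_ge0// ltW.
case=> [|h]; first by rewrite expr0 mulr1 lerDl divr_ge0// ltW.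
apply: le_trans (HK h) _; have r0' := ltW r0; rewrite exprS mulrA ler_wpM2r ?exprn_ge0//.
by rewrite mulrDl divfK ?gt_eqF// lerDr mulr_ge0.
Qed.

Lemma ma_coef_neg (n : nat) : ma_coef a (- n.+1%:Z) = 0.
Proof. by rewrite -NegzE. Qed.

Lemma ma_coef_lt0 (k : int) : k < 0 -> ma_coef a k = 0.
Proof. by case: k. Qed.

Lemma ma_coef_past (i j r : nat) : (i < j + r)%N ->
  ma_coef a (i%:Z - j%:Z - r%:Z) = 0.
Proof. by move=> ij; apply: ma_coef_lt0; lia. Qed.

Lemma ma_coef0 : ma_coef a 0 = 1.
Proof. by []. Qed.

Lemma ma_coefS (k : nat) :
  ma_coef a k.+1%:Z = \sum_(j < p) a j 0 * ma_coef a (k.+1%:Z - j.+1%:Z).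
Proof. by have /eqP := ma_coef_rec a k.+1; rewrite subr_eq0 => /eqP. Qed.

(** The constant 2^n is crude, and harmless where n is the fixed order p. *)
Lemma sqr_sum_le (n : nat) (x : 'I_n -> R) :
  (\sum_(i < n) x i) ^+ 2 <= 2 ^+ n * \sum_(i < n) x i ^+ 2.
Proof.
elim: n x => [|n IH] x; first by rewrite !big_ord0 expr0n mulr0.
rewrite !big_ord_recr /= [2 ^+ n.+1]exprS.
have /= := IH (fun i => x (widen_ord (leqnSn n) i)).
set S := \sum_(i < n) x _; set Q := \sum_(i < n) x _ ^+ 2 => {}IH.
have h : (S + x ord_max) ^+ 2 <= 2 * S ^+ 2 + 2 * x ord_max ^+ 2.
  by have := sqr_ge0 (S - x ord_max); nra.
apply: (le_trans h).
have e1 : (1 : R) <= 2 ^+ n by rewrite exprn_ege1// ler1n.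
have e2 := ler_wpM2r (sqr_ge0 (x ord_max)) e1.
lra.
Qed.

(** Let C_n be the polynomial with coefficients c_0, ..., c_(n-1).  For
    n >= 1, C_n(z) A(z) = 1 - z^n D_n(z) with D_n of degree less than p, and
    [remainder_coef n i] is the coefficient of z^i in D_n.  The remainder
    after n terms of the moving-average representation is therefore a
    combination of p values of the process, with coefficients as small
    as c_n. *)
Definition remainder_coef (n i : nat) : R :=
  \sum_(j < p | (i <= j)%N) a j 0 * ma_coef a (n%:Z + i%:Z - j.+1%:Z).

Lemma remainder_coef1 (i : 'I_p) : remainder_coef 1 i = a i 0.
Proof.
rewrite /remainder_coef (bigD1 i)//= (_ : _ - _ = 0); last by lia.
rewrite mulr1 big1 ?addr0// => j /andP[ij ji].
rewrite ma_coef_lt0 ?mulr0//.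
have : (i < j)%N by rewrite ltn_neqAle ij andbT eq_sym.
lia.
Qed.

Lemma remainder_coef0 (n : nat) : remainder_coef n.+1 0 = ma_coef a n.+1.
Proof. by rewrite ma_coefS; apply: eq_bigr => j _; rewrite addr0. Qed.

Lemma remainder_coef_p (n : nat) : remainder_coef n p = 0.
Proof. by rewrite /remainder_coef big1// => j pj; have := ltn_ord j; lia. Qed.

Lemma remainder_coefS (n : nat) (i : 'I_p) :
  remainder_coef n.+1 i = remainder_coef n i.+1 + ma_coef a n * a i 0.
Proof.
rewrite /remainder_coef (bigD1 i)//= (_ : _ - _ = n%:Z); last by lia.
rewrite addrC mulrC; congr (_ + _); apply: eq_big => j.
  by rewrite [RHS]ltn_neqAle andbC eq_sym.
by move=> _; congr (_ * ma_coef _ _); lia.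
Qed.

Lemma remainder_coef_bound (rho K : R) (n i : nat) : 0 < rho < 1 -> 0 <= K ->
  (forall h : nat, `|ma_coef a h%:Z| <= K * rho ^+ h) ->
  `|remainder_coef n i| <= (\sum_(j < p) `|a j 0|) * (K / rho ^+ p) * rho ^+ n.
Proof.
move=> /andP[r0 r1] K0 HK.
rewrite -mulrA mulr_suml; apply: le_trans (ler_norm_sum _ _ _) _.
apply: le_trans (ler_sum _ (_ : forall j : 'I_p, _ -> _ <= `|a j 0| * (K / rho ^+ p * rho ^+ n))) _.
- move=> j ij; rewrite normrM ler_wpM2l//.
  have [neg|pos] := ltP (n%:Z + i%:Z - j.+1%:Z) 0.
    by rewrite ma_coef_lt0// normr0 mulr_ge0// ?divr_ge0// exprn_ge0// ltW.
  move: pos; case kE: (n%:Z + i%:Z - j.+1%:Z) => [k|//] _.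
  apply: le_trans (HK k) _.
  rewrite mulrAC -mulrA ler_wpM2l// ler_pdivlMr ?exprn_gt0// -exprD.
  by rewrite ler_wiXn2l ?ltW//; have := ltn_ord j; lia.
- rewrite [leRHS](bigID (fun j : 'I_p => (i <= j)%N)) /= lerDl.
  by apply: sumr_ge0 => j _; rewrite mulr_ge0// mulr_ge0// ?divr_ge0// exprn_ge0// ltW.
Qed.

End decay_corollaries.

(** * Two-sided sums *)

Section two_sided_sums.
Context {R : realType}.
Implicit Types f : int -> R.

Lemma geometric_series_cvg (u : nat -> R) (K rho : R) : 0 < rho < 1 ->
  (forall n, `|u n| <= K * rho ^+ n) -> cvgn (series u).
Proof.
move=> /andP[r0 r1] H; apply: normed_cvg.
apply: (@series_le_cvg _ _ (geometric K rho)).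
- by move=> n; exact: normr_ge0.
- by move=> n; exact: le_trans (normr_ge0 _) (H n).
- by move=> n; exact: H.
- by apply: is_cvg_geometric_series; rewrite gtr0_norm.
Qed.

Lemma cvg_shiftP (k : nat) (u : nat -> R) (l : R) :
  (u (n + k)%N @[n --> \oo] --> l) <-> (u n @[n --> \oo] --> l).
Proof. by have E := cvg_shiftn k u (nbhs l); split=> H; [rewrite -E|rewrite E]. Qed.

Lemma cvg_bigsum (I : Type) (r : seq I) (u : I -> nat -> R) (l : I -> R) :
  (forall j, u j n @[n --> \oo] --> l j) ->
  \sum_(j <- r) u j n @[n --> \oo] --> \sum_(j <- r) l j.
Proof.
move=> H; elim: r => [|j r IH].
  by under eq_fun do rewrite big_nil; rewrite big_nil; exact: cvg_cst.
by under eq_fun do rewrite big_cons; rewrite big_cons; exact: cvgD.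
Qed.

Definition two_sided_sum f (n : nat) : R :=
  \sum_(0 <= l < n) f l%:Z + \sum_(0 <= l < n) f (- l.+1%:Z).

Lemma cvg_int_shift f (i : int) :
  f n%:Z @[n --> \oo] --> (0 : R) -> f (n%:Z + i) @[n --> \oo] --> (0 : R).
Proof.
case: i => k H; first exact: ((cvg_shiftP k (fun n => f n%:Z) 0).2 H).
apply: (cvg_shiftP k.+1 (fun n => f (n%:Z + Negz k)) 0).1.
rewrite [X in X @ _ --> _](_ : _ = fun n => f n%:Z)//.
by apply/funext => n; congr f; lia.
Qed.

(** A shift changes a partial sum only by terms at the two ends, which vanish
    in the limit. *)
Lemma two_sided_sum_shift f (j : nat) :
  f n%:Z @[n --> \oo] --> (0 : R) -> f (- n%:Z) @[n --> \oo] --> (0 : R) ->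
  (two_sided_sum (fun h => f (h - j%:Z)) n - two_sided_sum f n)
    @[n --> \oo] --> (0 : R).
Proof.
move=> f1 f2; elim: j => [|j IH].
  rewrite [X in X @ _ --> _](_ : _ = cst 0); first exact: cvg_cst.
  by apply/funext => n; under [X in two_sided_sum X]eq_fun do rewrite subr0; rewrite subrr.
have E n : two_sided_sum (fun h => f (h - j.+1%:Z)) n =
    two_sided_sum (fun h => f (h - j%:Z)) n + f (- n%:Z - j.+1%:Z) - f (n%:Z - j.+1%:Z).
  rewrite /two_sided_sum; elim: n => [|n IHn].
    have -> : - 0%:Z - j.+1%:Z = 0%:Z - j.+1%:Z by lia.
    by rewrite !big_geq// !add0r subrr.
  rewrite !big_nat_recr//= addrACA IHn.
  have -> : f (- n.+1%:Z - j%:Z) = f (- n%:Z - j.+1%:Z) by congr f; lia.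
  have -> : f (n.+1%:Z - j.+1%:Z) = f (n%:Z - j%:Z) by congr f; lia.
  ring.
rewrite [X in X @ _ --> _](_ : _ = fun n =>
   (two_sided_sum (fun h => f (h - j%:Z)) n - two_sided_sum f n) +
   f (- n%:Z - j.+1%:Z) - f (n%:Z - j.+1%:Z)); last first.
  by apply/funext => n; rewrite E; ring.
rewrite -[X in _ --> X]addr0 -[X in _ --> X]subr0.
apply: cvgB; last exact: cvg_int_shift.
apply: cvgD => //.
rewrite [X in X @ _ --> _](_ : _ = fun n : nat => (f \o -%R) (n%:Z + j.+1%:Z)).
  exact: (cvg_int_shift (f := f \o -%R)).
by apply/funext => n /=; congr f; lia.
Qed.

Variables (p : nat) (a : 'cV[R]_p) (nu : R) (g : int -> R) (rho : R).
Local Notation c := (ma_coef a).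
Hypothesis rho01 : 0 < rho < 1.
Hypothesis gN : forall h, g (- h) = g h.
Hypothesis g_yw : forall h,
  g h - \sum_(j < p) a j 0 * g (h - j.+1%:Z) = nu ^+ 2 * c (- h).
Hypothesis g_geo : exists2 K, 0 <= K & forall h : nat, `|g h%:Z| <= K * rho ^+ h.
Hypothesis c_geo : exists2 K, 0 <= K & forall h : nat, `|c h%:Z| <= K * rho ^+ h.

Let A1 := 1 - \sum_(j < p) a j 0.

Lemma geometric_cvg0 (u : nat -> R) (K : R) :
  (forall n, `|u n| <= K * rho ^+ n) -> u n @[n --> \oo] --> (0 : R).
Proof.
by move=> H; apply: cvg_series_cvg_0; exact: geometric_series_cvg H.
Qed.

(** Summation turns the autoregressive filter into multiplication by A(1). *)
Lemma two_sided_filter f (S T : R) :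
  f n%:Z @[n --> \oo] --> (0 : R) -> f (- n%:Z) @[n --> \oo] --> (0 : R) ->
  two_sided_sum f n @[n --> \oo] --> S ->
  two_sided_sum (fun h => f h - \sum_(j < p) a j 0 * f (h - j.+1%:Z)) n
    @[n --> \oo] --> T ->
  A1 * S = T.
Proof.
move=> f1 f2 fS fT.
suff H : two_sided_sum (fun h => f h - \sum_(j < p) a j 0 * f (h - j.+1%:Z)) n
    @[n --> \oo] --> A1 * S by exact: cvg_unique H fT.
rewrite [X in X @ _ --> _](_ : _ = fun n => two_sided_sum f n -
   \sum_(j < p) a j 0 * two_sided_sum (fun h => f (h - j.+1%:Z)) n); last first.
  apply/funext => n; rewrite /two_sided_sum.
  under [X in _ - X]eq_bigr do rewrite mulrDr !mulr_sumr.
  by rewrite !sumrB big_split /= !(exchange_big _ _ (index_enum 'I_p)) /=; ring.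
rewrite mulrBl mul1r mulr_suml; apply: cvgB => //.
apply: cvg_bigsum => j; apply: cvgM; first exact: cvg_cst.
rewrite -[X in _ --> X]add0r.
rewrite [X in X @ _ --> _](_ : _ = fun n =>
  (two_sided_sum (fun h => f (h - j.+1%:Z)) n - two_sided_sum f n) +
  two_sided_sum f n); last by apply/funext => n; rewrite subrK.
by apply: cvgD => //; exact: two_sided_sum_shift.
Qed.

(** Filtering c yields the unit impulse, so A(1) sum c = 1; filtering g yields
    nu^2 times the reflection of c, so A(1) sum g = nu^2 sum c. *)
Lemma two_sided_sum_autocov :
  limn (series (fun l : nat => g l%:Z)) +
  limn (series (fun l : nat => g (- l.+1%:Z))) = nu ^+ 2 / A1 ^+ 2.
Proof.
have [K K0 HK] := g_geo; have [C C0 HC] := c_geo; have /andP[r0 r1] := rho01.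
have g1 := geometric_cvg0 HK.
have g2 : g (- n%:Z) @[n --> \oo] --> (0 : R) by under eq_fun do rewrite gN.
have c1 := geometric_cvg0 HC.
have c2 : c (- n%:Z) @[n --> \oo] --> (0 : R).
  apply/(cvg_shiftP 1); under eq_fun do rewrite addn1 ma_coef_lt0//.
  exact: cvg_cst.
pose Sc := limn (series (fun l : nat => c l%:Z)).
have cSc : series (fun l : nat => c l%:Z) n @[n --> \oo] --> Sc.
  exact: geometric_series_cvg HC.
have E1 : A1 * Sc = 1.
  apply: (@two_sided_filter c) => //.
    under eq_fun do rewrite /two_sided_sum [X in _ + X]big1 ?addr0//.
    exact: cSc.
  apply/(cvg_shiftP 1).
  rewrite [X in X @ _ --> _](_ : _ = cst 1); first exact: cvg_cst.
  apply/funext => n; rewrite addn1 /two_sided_sum.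
  rewrite [X in _ + X]big1 ?addr0; last first.
    move=> l _; rewrite ma_coef_neg big1 ?subr0// => j _.
    by rewrite ma_coef_lt0 ?mulr0//; lia.
  under eq_bigr do rewrite ma_coef_rec.
  by rewrite big_nat_recl// big1 ?addr0.
have A10 : A1 != 0.
  by apply: contra_eqN E1 => /eqP ->; rewrite mul0r eq_sym oner_eq0.
set Sg := _ + _.
have cSg : two_sided_sum g n @[n --> \oo] --> Sg.
  apply: cvgD; first exact: geometric_series_cvg HK.
  apply: (@geometric_series_cvg _ K rho) => // n; rewrite gN.
  apply: le_trans (HK n.+1) _; rewrite ler_wpM2l// exprS ler_piMl ?exprn_ge0// ltW//.
have E2 : A1 * Sg = nu ^+ 2 * Sc.
  apply: (@two_sided_filter g) => //.
  apply/(cvg_shiftP 1).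
  rewrite [X in X @ _ --> _](_ : _ = fun n => nu ^+ 2 * series (fun l : nat => c l%:Z) (n + 2)%N).
    apply: cvgM; first exact: cvg_cst.
    exact: ((cvg_shiftP 2 (fun n => series (fun l : nat => c l%:Z) n) Sc).2 cSc).
  (* The sum of c(-h) over the window -(n+1), ..., n is c_0 + ... + c_(n+1). *)
  apply/funext => n; rewrite addn1 addn2 /two_sided_sum /series /=.
  under eq_bigr do rewrite g_yw.
  under [X in _ + X]eq_bigr do rewrite g_yw opprK.
  rewrite big_nat_recl// [X in _ + X + _]big1 ?addr0 => [|l _]; last first.
    by rewrite ma_coef_neg mulr0.
  by rewrite -mulr_sumr oppr0 -mulrDr; congr (_ * _); rewrite [RHS]big_nat_recl.
have ScE : Sc = A1^-1 by apply: (mulfI A10); rewrite E1 mulfV.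
by apply: (mulfI A10); rewrite E2 ScE; field.
Qed.

End two_sided_sums.

(** * The autoregressive process *)

Definition diff_autocov {R : realType} (g : int -> R) (r h : int) : R :=
  2 * g h - g (h - r) - g (h + r).

Definition lag_difference {R : realType} {Omega : Type} (eps : int -> Omega -> R)
    (r t : int) (w : Omega) : R :=
  eps t w - eps (t - r) w.

Section process.
Context {d : measure_display} {Omega : measurableType d} {R : realType}.
Variable P : probability Omega R.
Variables (p : nat) (a : 'cV[R]_p) (eps eta : int -> {RV P >-> R}) (nu : R).
Hypothesis eta_iid : iid eta.
Hypothesis eta_mean : forall t, ('E_P[eta t] = 0)%E.
Hypothesis eta_var :
  forall t, ('E_P[(fun w => eta t w ^+ 2)%R] = (nu ^+ 2)%:E)%E.
Hypothesis eta_fourth :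
  forall t, ('E_P[(fun w => eta t w ^+ 4)%R] < +oo)%E.
Hypothesis eps_stationary : stationary eps.
Hypothesis eps_ar : ar_equation a eps eta.
Hypothesis a_causal : causal a.

Let L2_eta := L2_eta eta_fourth.
Local Notation c := (ma_coef a).

Lemma eps_measurable t : measurable_fun setT (eps t).
Proof. exact: measurable_funPT. Qed.
Hint Resolve eps_measurable : core.

Lemma L2_eps t : L2 P (eps t).
Proof.
have [e2 _ _] := eps_stationary; split=> //.
apply/integrableP; split; first by apply/measurable_EFinP; exact: measurable_funX.
have := e2 t; rewrite unlock; congr (_ < _)%E.
by apply: eq_integral => w _ /=; rewrite ger0_norm ?sqr_ge0.
Qed.

(** Causality at z = 1. *)
Lemma ar_polynomial1_neq0 : 1 - \sum_(j < p) a j 0 != 0.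
Proof.
have := a_causal (z := 1%:C%C); rewrite normr1 lexx => /(_ isT).
apply: contraNneq => H.
rewrite [X in 1 - X](_ : _ = (\sum_(j < p) a j 0)%:C%C); last first.
  by rewrite rmorph_sum; apply: eq_bigr => j _; rewrite expr1n mulr1.
by rewrite -[1]/(1%:C%C) -rmorphB H.
Qed.

(** Stationarity and the autoregressive equation give A(1) E eps = 0. *)
Lemma mean_eps t : mean P (eps t) = 0.
Proof.
have [_ e1 _] := eps_stationary.
have E s : mean P (eps s) = mean P (eps t).
  by have := e1 s t; rewrite unlock /mean /Rintegral => ->.
have L1e s : L1 P (eps s) by exact/L2_L1/L2_eps.
have L1s : L1 P (fun w => \sum_(j < p) a j 0 * eps (t - j.+1%:Z) w).
  by apply: L1_sum => j; exact: L1Z.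
have [_] := mean_ae (L1e t) (L1_measurable (L1D L1s (L2_L1 (L2_eta t)))) (eps_ar t).
rewrite meanD ?(mean_eta eta_mean) ?addr0//; last exact/L2_L1/L2_eta.
rewrite mean_sum; last by move=> j; exact: L1Z.
under eq_bigr do rewrite meanZ// E.
rewrite -mulr_suml => /eqP; rewrite -subr_eq0 -{1}[mean _ _]mul1r -mulrBl.
by rewrite mulf_eq0 (negPf ar_polynomial1_neq0) => /eqP.
Qed.

Definition autocov (h : int) : R := mean P (fun w => eps 0 w * eps h w).

Lemma covariance_eps s t :
  covariance P (eps s) (eps t) = (mean P (fun w => eps s w * eps t w))%:E.
Proof.
have m0 u : fine ('E_P[eps u])%E = 0.
  by rewrite -[RHS](mean_eps u) /mean /Rintegral unlock.
rewrite unlock !m0 unlock /mean /Rintegral fineK; last first.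
  by apply: integrable_fin_num => //; exact: (L2M (L2_eps s) (L2_eps t)).
apply: eq_integral => w _; congr (_%:E).
by rewrite /GRing.mul /= /cst !subr0.
Qed.

Lemma mean_epsM s t : mean P (fun w => eps s w * eps t w) = autocov (t - s).
Proof.
have [_ _ H] := eps_stationary; apply: EFin_inj; rewrite -!covariance_eps.
by rewrite -(H 0 (t - s) s) add0r subrK.
Qed.

Lemma autocovN h : autocov (- h) = autocov h.
Proof.
rewrite -[h in RHS]subr0 -mean_epsM; under eq_fun do rewrite mulrC.
by rewrite mean_epsM sub0r.
Qed.

Definition ma_part (n : nat) (t : int) (w : Omega) : R :=
  \sum_(k < n) c k%:Z * eta (t - k%:Z) w.

Definition remainder (n : nat) (t : int) (w : Omega) : R :=
  eps t w - ma_part n t w.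

Lemma L2_ma_part n t : L2 P (ma_part n t).
Proof. by apply: L2_sum => k; exact: L2Z. Qed.

Lemma L2_remainder n t : L2 P (remainder n t).
Proof. by apply: L2B; [exact: L2_eps|exact: L2_ma_part]. Qed.

(** Induction on n: the leading term of the remainder is c_n eps_(t-n), and the
    autoregressive equation at time t - n replaces it by c_n eta_(t-n) and p
    earlier values of the process. *)
Lemma remainder_ae n t : {ae P, forall w,
  \sum_(i < p) remainder_coef a n.+1 i * eps (t - n.+1%:Z - i%:Z) w =
  remainder n.+1 t w}.
Proof.
elim: n => [|n IH].
  apply: filterS (eps_ar t) => w; rewrite /remainder /ma_part big_ord1 ma_coef0.
  rewrite mul1r subr0 => ->; rewrite addrK; apply: eq_bigr => i _.
  rewrite remainder_coef1; congr (_ * eps _ _); lia.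
have H := eps_ar (t - n.+1%:Z).
apply: filterS2 IH H => w IH H.
rewrite /remainder /ma_part big_ord_recr /= opprD addrA -/(ma_part n.+1 t w).
rewrite -/(remainder n.+1 t w) -IH; apply/eqP; rewrite eq_sym subr_eq; apply/eqP.
transitivity (\sum_(i < p.+1) remainder_coef a n.+1 i * eps (t - n.+1%:Z - i%:Z) w).
  by rewrite big_ord_recr /= remainder_coef_p mul0r addr0.
rewrite big_ord_recl /= subr0 remainder_coef0 H mulrDr addrAC; congr (_ + _).
rewrite mulr_sumr -big_split /=; apply: eq_bigr => j _.
rewrite remainder_coefS mulrDl addrC /bump /= add1n; congr (_ * eps _ _ + _).
  by lia.
by rewrite mulrA; congr (_ * eps _ _); lia.
Qed.

Variable rho : R.
Hypothesis rho01 : 0 < rho < 1.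
Hypothesis rho_geometric : forall f : int -> R,
  (forall h : nat, f h.+1%:Z = \sum_(j < p) a j 0 * f (h.+1%:Z - j.+1%:Z)) ->
  exists2 K, 0 <= K & forall h : nat, `|f h%:Z| <= K * rho ^+ h.

Let rho_gt0 : 0 < rho. Proof. by case/andP: rho01. Qed.
Let rho_ge0 : 0 <= rho. Proof. exact: ltW. Qed.

Lemma ma_coef_geometric :
  exists2 K, 0 <= K & forall h : nat, `|c h%:Z| <= K * rho ^+ h.
Proof. exact/rho_geometric/ma_coefS. Qed.

Lemma mean_remainder_sqr : exists2 K, 0 <= K & forall n t,
  mean P (fun w => remainder n.+1 t w ^+ 2) <= K * (rho ^+ n.+1) ^+ 2.
Proof.
have [K K0 HK] := ma_coef_geometric.
pose D := (\sum_(j < p) `|a j 0|) * (K / rho ^+ p).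
have D0 : 0 <= D.
  by rewrite mulr_ge0 ?sumr_ge0// divr_ge0// exprn_ge0.
have HD n i : `|remainder_coef a n i| <= D * rho ^+ n.
  exact: remainder_coef_bound.
move: D D0 HD => D D0 HD.
have g0 : 0 <= autocov 0 by apply: mean_ge0 => w; rewrite -expr2 sqr_ge0.
exists (2 ^+ p * (p%:R * (D ^+ 2 * autocov 0))).
  by rewrite mulr_ge0 ?exprn_ge0// mulr_ge0// mulr_ge0// sqr_ge0.
move=> n t.
pose e (i : 'I_p) := eps (t - n.+1%:Z - i%:Z).
have L2S : L2 P (fun w => \sum_(i < p) remainder_coef a n.+1 i * e i w).
  by apply: L2_sum => i; apply: L2Z; exact: L2_eps.
have [||_ <-] := mean_ae (g := fun w => remainder n.+1 t w ^+ 2) L2S.2.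
- by apply: measurable_funX; have [] := L2_remainder n.+1 t.
- by apply: filterS (remainder_ae n t) => w <-.
have L1e (i : 'I_p) : L1 P (fun w => (remainder_coef a n.+1 i * e i w) ^+ 2).
  exact: (L2Z _ (L2_eps _)).2.
apply: (@le_trans _ _ (mean P (fun w =>
  2 ^+ p * \sum_(i < p) (remainder_coef a n.+1 i * e i w) ^+ 2))).
  apply: le_mean; first exact: L2S.2.
    by apply/L1Z/L1_sum.
  by move=> w; exact: sqr_sum_le.
rewrite meanZ; last exact: L1_sum.
rewrite mean_sum// -!mulrA ler_wpM2l ?exprn_ge0//.
rewrite [leRHS](_ : _ = \sum_(i < p) D ^+ 2 * (rho ^+ n.+1) ^+ 2 * autocov 0); last first.
  by rewrite sumr_const card_ord -[RHS]mulr_natl; ring.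
apply: ler_sum => i _; under eq_fun do rewrite exprMn.
rewrite meanZ; last exact: (L2_eps _).2.
have -> : mean P (fun w => e i w ^+ 2) = autocov 0.
  by rewrite -[0](subrr (t - n.+1%:Z - i%:Z)) -mean_epsM.
rewrite ler_wpM2r// -exprMn -[leLHS]real_normK ?num_real//.
rewrite ler_sqr ?nnegrE// ?mulr_ge0// ?exprn_ge0//.
Qed.

(** The weight is the inverse of rho^n, so that both halves of the weighted
    bound are of the order of rho^n. *)
Lemma mean_remainderM : exists2 K, 0 <= K & forall n t (Z : Omega -> R),
  L2 P Z -> mean P (fun w => `|remainder n.+1 t w * Z w|) <=
            rho ^+ n.+1 * (K + mean P (fun w => Z w ^+ 2)).
Proof.
have [K K0 HK] := mean_remainder_sqr; exists K => // n t Z Z2.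
have r0 : 0 < rho ^+ n.+1 by rewrite exprn_gt0.
have := mean_normM_le (l := (rho ^+ n.+1)^-1) _ (L2_remainder n.+1 t) Z2.
rewrite invr_gt0 => /(_ r0) /le_trans; apply; rewrite invrK.
have h1 : (rho ^+ n.+1)^-1 * mean P (fun w => remainder n.+1 t w ^+ 2) <= K * rho ^+ n.+1.
  by rewrite mulrC ler_pdivrMr// -mulrA -expr2; exact: HK.
have z0 : 0 <= mean P (fun w => Z w ^+ 2) by apply: mean_ge0 => w; exact: sqr_ge0.
have := mulr_ge0 (ltW r0) z0; have := mulr_ge0 (ltW r0) K0; lra.
Qed.

Lemma geometric_eq0 (x C : R) (N : nat) :
  (forall n, (N <= n)%N -> `|x| <= C * rho ^+ n) -> x = 0.
Proof.
move=> H; apply/eqP; rewrite -normr_le0.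
exact: (geometric_le0 rho01 H).
Qed.

(** The truncated representation has exactly this cross moment once it is longer
    than t - s, and the remainder contributes an arbitrarily small amount. *)
Lemma mean_eps_eta t s : mean P (fun w => eps t w * eta s w) = nu ^+ 2 * c (t - s).
Proof.
have [K K0 HK] := mean_remainderM.
apply/eqP; rewrite -subr_eq0; apply/eqP.
apply: (@geometric_eq0 _ (K + nu ^+ 2) `|t - s|.+1) => -[//|n] Nn.
have L1R : L1 P (fun w => remainder n.+1 t w * eta s w).
  by apply: L2M => //; exact: L2_remainder.
have L1M : L1 P (fun w => ma_part n.+1 t w * eta s w).
  by apply: L2M => //; exact: L2_ma_part.
have E : mean P (fun w => ma_part n.+1 t w * eta s w) = nu ^+ 2 * c (t - s).
  under eq_fun do rewrite /ma_part mulr_suml.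
  rewrite (@mean_sum _ _ _ P _ _ _
    (fun (k : 'I_n.+1) w => c k%:Z * eta (t - k%:Z) w * eta s w)); last first.
    by move=> k; under eq_fun do rewrite -mulrA; exact/L1Z/L2M.
  under eq_bigr => k _.
    under eq_fun do rewrite -mulrA.
    rewrite meanZ ?(mean_etaM eta_iid eta_mean eta_var eta_fourth)//; last exact: L2M.
    over.
  have [neg|] := ltP (t - s) 0.
    rewrite ma_coef_lt0// mulr0 big1// => k _.
    by rewrite (_ : _ == _ = false) ?mulr0//; lia.
  move: Nn; case mE: (t - s) => [m|//] Nn _.
  have mn : (m < n.+1)%N by rewrite -ltnS; exact: Nn.
  rewrite (bigD1 (Ordinal mn))//= (_ : _ == _ = true); last by lia.
  rewrite mulr1 mulrC big1 ?addr0// => k /eqP km.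
  rewrite (_ : _ == _ = false) ?mulr0//; apply/negbTE/eqP => tk; apply: km.
  by apply/val_inj => /=; lia.
rewrite -E -meanB//; last by apply: L2M => //; exact: L2_eps.
apply: (@le_trans _ _ (mean P (fun w => `|remainder n.+1 t w * eta s w|))).
  under [X in `|mean _ X|]eq_fun do rewrite -mulrBl.
  exact: normr_mean_le.
apply: le_trans (HK _ _ _ (L2_eta s)) _.
by rewrite (mean_eta_sqr eta_var) mulrC.
Qed.

(** The equation at time h multiplied by eps_0.  It is valid for h of either
    sign because the right-hand side is the actual covariance of eta_h and
    eps_0, which vanishes for h > 0. *)
Lemma yule_walker h :
  autocov h - \sum_(j < p) a j 0 * autocov (h - j.+1%:Z) = nu ^+ 2 * c (- h).
Proof.
have -> : nu ^+ 2 * c (- h) = mean P (fun w => eta h w * eps 0 w).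
  by rewrite -sub0r -mean_eps_eta; under eq_fun do rewrite mulrC.
have gE k : autocov k = mean P (fun w => eps k w * eps 0 w).
  by rewrite -autocovN -sub0r -mean_epsM.
have L1s : L1 P (fun w => \sum_(j < p) a j 0 * (eps (h - j.+1%:Z) w * eps 0 w)).
  by apply: L1_sum => j; apply/L1Z/L2M; exact: L2_eps.
have L1he : L1 P (fun w => eta h w * eps 0 w) by apply: L2M => //; exact: L2_eps.
rewrite gE.
have [||_ ->] := mean_ae (g := fun w =>
    \sum_(j < p) a j 0 * (eps (h - j.+1%:Z) w * eps 0 w) + eta h w * eps 0 w)
  (L2M (L2_eps h) (L2_eps 0)).
- exact: L1_measurable (L1D L1s L1he).
- apply: filterS (eps_ar h) => w ->; rewrite mulrDl mulr_suml; congr (_ + _).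
  by apply: eq_bigr => j _; rewrite mulrA.
rewrite meanD// mean_sum; last by move=> j; apply/L1Z/L2M; exact: L2_eps.
have -> : \sum_(j < p) mean P (fun w => a j 0 * (eps (h - j.+1%:Z) w * eps 0 w)) =
    \sum_(j < p) a j 0 * autocov (h - j.+1%:Z).
  by apply: eq_bigr => j _; rewrite meanZ ?gE//; apply: L2M; exact: L2_eps.
by rewrite addrAC subrr add0r.
Qed.

Lemma autocov_geometric :
  exists2 K, 0 <= K & forall h : nat, `|autocov h%:Z| <= K * rho ^+ h.
Proof.
apply: rho_geometric => h; apply/eqP; rewrite -subr_eq0 yule_walker.
by rewrite ma_coef_neg mulr0.
Qed.

Let cp := centred_prod eta nu.
Let kp := centred_prod_bound eta nu.

Definition trunc_autocov (n : nat) (s s' : int) : R :=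
  \sum_(j < n) \sum_(k < n)
    c j%:Z * c k%:Z * (nu ^+ 2 * (s - j%:Z == s' - k%:Z)%:R).

Lemma ma_partM n (s s' : int) (t : nat) w :
  ma_part n (s + t%:Z) w * ma_part n (s' + t%:Z) w =
  \sum_(j < n) \sum_(k < n)
    c j%:Z * c k%:Z * cp (s - j%:Z + t%:Z) (s' - k%:Z + t%:Z) w +
  trunc_autocov n s s'.
Proof.
rewrite /ma_part mulr_suml -big_split /=; apply: eq_bigr => j _.
rewrite mulr_sumr -big_split /=; apply: eq_bigr => k _.
rewrite -mulrDr /cp /centred_prod.
have -> : (s - j%:Z + t%:Z == s' - k%:Z + t%:Z) = (s - j%:Z == s' - k%:Z).
  by apply/eqP/eqP; lia.
rewrite subrK mulrACA [s - _ + _]addrAC [s' - _ + _]addrAC.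
by congr (_ * (eta _ _ * eta _ _)).
Qed.

Lemma mean_centred_prod x y : mean P (cp x y) = 0.
Proof.
rewrite /cp /centred_prod meanB; last 2 first.
- exact/L2_L1/L2_etaM.
- exact: L1_cst.
by rewrite mean_cst (mean_etaM eta_iid eta_mean eta_var eta_fourth) subrr.
Qed.

Lemma L1_centred_prod x y : L1 P (cp x y).
Proof. exact/L2_L1/L2_centred_prod. Qed.

Lemma mean_ma_partM n (s s' : int) :
  mean P (fun w => ma_part n s w * ma_part n s' w) = trunc_autocov n s s'.
Proof.
have E w : ma_part n s w * ma_part n s' w = \sum_(j < n) \sum_(k < n)
    c j%:Z * c k%:Z * cp (s - j%:Z) (s' - k%:Z) w + trunc_autocov n s s'.
  have := ma_partM n s s' 0 w; rewrite !addr0 => ->; congr (_ + _).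
  by apply: eq_bigr => j _; apply: eq_bigr => k _; rewrite !addr0.
under eq_fun do rewrite E.
have L1k j k : L1 P (fun w => c j%:Z * c k%:Z * cp (s - j%:Z) (s' - k%:Z) w).
  exact/L1Z/L1_centred_prod.
have L1j j : L1 P (fun w => \sum_(k < n) c j%:Z * c k%:Z * cp (s - j%:Z) (s' - k%:Z) w).
  exact: L1_sum.
rewrite meanD ?mean_cst; last exact: L1_cst; last exact: L1_sum.
rewrite mean_sum// big1 ?add0r// => j _; rewrite mean_sum// big1// => k _.
by rewrite meanZ ?mean_centred_prod ?mulr0//; exact: L1_centred_prod.
Qed.

(** The triangle inequality over the pairs (j, k) loses nothing in the order of
    magnitude, because the coefficients are absolutely summable and each inner
    sum is of order sqrt N uniformly. *)
Lemma mean_norm_sum_ma_partM n (s s' : int) (N : nat) :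
  mean P (fun w => `|\sum_(t < N) (ma_part n (s + t%:Z) w * ma_part n (s' + t%:Z) w
                                   - trunc_autocov n s s')|) <=
  (\sum_(k < n) `|c k%:Z|) ^+ 2 * ((kp + 1) * Num.sqrt N%:R).
Proof.
pose F (j k : 'I_n) w := \sum_(t < N) cp (s - j%:Z + t%:Z) (s' - k%:Z + t%:Z) w.
have E w : \sum_(t < N) (ma_part n (s + t%:Z) w * ma_part n (s' + t%:Z) w
      - trunc_autocov n s s') =
    \sum_(j < n) \sum_(k < n) c j%:Z * c k%:Z * F j k w.
  under eq_bigr do rewrite ma_partM addrK.
  rewrite exchange_big; apply: eq_bigr => j _; rewrite exchange_big.
  by apply: eq_bigr => k _; rewrite mulr_sumr.
under eq_fun do rewrite E.
have L1F j k : L1 P (F j k) by apply: L1_sum => t; exact: L1_centred_prod.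
have L1k (j k : 'I_n) : L1 P (fun w => c j%:Z * c k%:Z * F j k w) by exact: L1Z.
apply: le_trans (mean_norm_sum _ _ _) _; first by move=> j; exact: L1_sum.
rewrite expr2 -mulrA mulr_suml; apply: ler_sum => j _.
apply: le_trans (mean_norm_sum _ _ _) _; first exact: L1k.
rewrite mulr_suml mulr_sumr; apply: ler_sum => k _.
rewrite mean_normZ// normrM mulrA ler_wpM2l ?mulr_ge0//.
exact: mean_norm_sum_centred_prod.
Qed.

(** With eps = X + r, the difference eps eps' - X X' equals
    r eps' + r' eps - r r'. *)
Lemma mean_epsM_ma_partM : exists2 K, 0 <= K & forall n (s s' : int),
  mean P (fun w => `|eps s w * eps s' w - ma_part n.+1 s w * ma_part n.+1 s' w|)
  <= K * rho ^+ n.+1.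
Proof.
have [K K0 HK] := mean_remainderM; have [K' K'0 HK'] := mean_remainder_sqr.
have g0 : 0 <= autocov 0 by apply: mean_ge0 => w; rewrite -expr2 sqr_ge0.
have gE t : mean P (fun w => eps t w ^+ 2) = autocov 0.
  by rewrite -[0](subrr t) -mean_epsM.
exists (3 * K + 2 * autocov 0 + K'); first by rewrite !addr_ge0// mulr_ge0.
move=> n s s'.
pose r := remainder n.+1.
have L2r t : L2 P (r t) by exact: L2_remainder.
have E w : eps s w * eps s' w - ma_part n.+1 s w * ma_part n.+1 s' w =
    r s w * eps s' w + r s' w * eps s w + (-1) * (r s w * r s' w).
  by rewrite /r /remainder; ring.
under eq_fun do rewrite E.
have i1 : L1 P (fun w => r s w * eps s' w) by apply: L2M => //; exact: L2_eps.
have i2 : L1 P (fun w => r s' w * eps s w) by apply: L2M => //; exact: L2_eps.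
have i3 : L1 P (fun w => r s w * r s' w) by exact: L2M.
apply: le_trans (mean_normD (L1D i1 i2) (L1Z (-1) i3)) _.
have h12 := mean_normD i1 i2.
rewrite mean_normZ// normrN1 mul1r.
have h1 := HK n s _ (L2_eps s'); have h2 := HK n s' _ (L2_eps s).
have h3 := HK n s _ (L2r s').
rewrite !gE in h1 h2.
have r1 : (rho ^+ n.+1) ^+ 2 <= 1.
  by rewrite -exprM exprn_ile1// ltW//; case/andP: rho01.
have h4 : mean P (fun w => r s' w ^+ 2) <= K'.
  by apply: le_trans (HK' _ _) _; rewrite ler_piMr.
have h5 := ler_wpM2l (exprn_ge0 n.+1 rho_ge0) h4.
rewrite -/(r s) -/(r s') in h1 h2 h3.
by move: (rho ^+ n.+1) h1 h2 h3 h5 => x h1 h2 h3 h5; lra.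
Qed.

Lemma ma_coef_summable : exists2 K, 0 <= K & forall n : nat,
  \sum_(k < n) `|c k%:Z| <= K.
Proof.
have [K K0 HK] := ma_coef_geometric; have /andP[_ r1] := rho01.
have d0 : 0 < 1 - rho by rewrite subr_gt0.
exists (K / (1 - rho)); first by rewrite divr_ge0// ltW.
move=> n; rewrite ler_pdivlMr//.
suff : (\sum_(k < n) `|c k%:Z|) * (1 - rho) <= K * (1 - rho ^+ n).
  move=> /le_trans; apply; rewrite ler_piMr// gerBl.
  by rewrite exprn_ge0.
elim: n => [|n IH]; first by rewrite big_ord0 mul0r expr0 subrr mulr0.
rewrite big_ord_recr /= mulrDl.
have := ler_wpM2r (ltW d0) (HK n); rewrite exprS.
move: (rho ^+ n) IH => x; lra.
Qed.

(** For fixed N the error of truncation after n terms is of order N rho^n, and n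
    is arbitrary. *)
Lemma mean_norm_autocov_sum : exists2 K, 0 <= K & forall (N : nat) (s s' : int),
  mean P (fun w => `|\sum_(t < N) (eps (s + t%:Z) w * eps (s' + t%:Z) w
                                   - autocov (s' - s))|) <= K * Num.sqrt N%:R.
Proof.
have [K K0 HK] := mean_epsM_ma_partM; have [C C0 HC] := ma_coef_summable.
have kp0 : 0 <= kp by exact: centred_prod_bound_ge0.
exists (C ^+ 2 * (kp + 1)); first by rewrite mulr_ge0 ?sqr_ge0// addr_ge0.
move=> N s s'; rewrite -subr_le0.
apply: (@geometric_le0 _ rho _ (2 * N%:R * K) 1) => // -[//|n] _.
pose X t := ma_part n.+1 t; pose g := trunc_autocov n.+1 s s'.
pose Dt (t : nat) w := eps (s + t%:Z) w * eps (s' + t%:Z) w - X (s + t%:Z) w * X (s' + t%:Z) w.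
have L1X t t' : L1 P (fun w => X t w * X t' w) by apply: L2M; exact: L2_ma_part.
have L1e t t' : L1 P (fun w => eps t w * eps t' w) by apply: L2M; exact: L2_eps.
have L1D' t : L1 P (Dt t) by exact: L1B.
(* Truncation errors, centred truncated products, and the difference of the
   two centring constants. *)
have E w : \sum_(t < N) (eps (s + t%:Z) w * eps (s' + t%:Z) w - autocov (s' - s)) =
    (\sum_(t < N) Dt t w + \sum_(t < N) (X (s + t%:Z) w * X (s' + t%:Z) w - g))
    + N%:R * (g - autocov (s' - s)).
  have -> : N%:R * (g - autocov (s' - s)) = \sum_(t < N) (g - autocov (s' - s)).
    by rewrite sumr_const card_ord mulr_natl.
  by rewrite -!big_split /=; apply: eq_bigr => t _; rewrite /Dt; ring.
under eq_fun do rewrite E.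
have L1XS : L1 P (fun w => \sum_(t < N) (X (s + t%:Z) w * X (s' + t%:Z) w - g)).
  by apply: L1_sum => t; apply: L1B => //; exact: L1_cst.
have L1DS : L1 P (fun w => \sum_(t < N) Dt t w) by exact: L1_sum.
have b1 := mean_normD (L1D L1DS L1XS) (L1_cst P (N%:R * (g - autocov (s' - s)))).
have b2 := mean_normD L1DS L1XS.
have b3 : mean P (fun w => `|\sum_(t < N) Dt t w|) <= N%:R * (K * rho ^+ n.+1).
  apply: le_trans (mean_norm_sum _ _ _) _; first exact: L1D'.
  rewrite mulr_natl -[N in leRHS]card_ord -sumr_const; apply: ler_sum => t _; exact: HK.
have b4 : `|g - autocov (s' - s)| <= K * rho ^+ n.+1.
  rewrite distrC -mean_epsM /g -mean_ma_partM -meanB//.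
  by apply: le_trans (normr_mean_le _) (HK n s s'); exact: L1B.
have b5 := mean_norm_sum_ma_partM n.+1 s s' N.
have b6 : (\sum_(k < n.+1) `|c k%:Z|) ^+ 2 * ((kp + 1) * Num.sqrt N%:R) <=
    C ^+ 2 * (kp + 1) * Num.sqrt N%:R.
  rewrite -[leRHS]mulrA; apply: ler_wpM2r.
    by rewrite mulr_ge0 ?sqrtr_ge0// addr_ge0.
  by rewrite ler_sqr ?nnegrE ?sumr_ge0.
rewrite mean_cst normrM normr_nat in b1.
have b7 := ler_wpM2l (ler0n R N) b4.
rewrite lerBlDr; apply: (le_trans b1).
rewrite -/X -/g in b5.
move: b2 b3 b5 b6 b7 => b2 b3 b5 b6 b7.
have b8 := le_trans b5 b6.
lra.
Qed.

Hypothesis nu2_gt0 : 0 < nu ^+ 2.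

Let past_innovation (i : 'I_p) : Omega -> R := eta (- i%:Z).

Let L2_past_innovation i : L2 P (past_innovation i).
Proof. exact: L2_eta. Qed.

(** The variable eps_(-i) is correlated with eta_(-i), and eps_(-j) with j > i
    lies in the past of that innovation. *)
Lemma autocov_unitmx : \matrix_(i < p, j < p) autocov (i%:Z - j%:Z) \in unitmx.
Proof.
apply: (@gram_unitmx _ _ _ P _ (fun i => eps (- i%:Z)) past_innovation) => //.
- by move=> i; exact: L2_eps.
- by move=> i j; rewrite mxE mean_epsM; congr autocov; ring.
- by move=> i; rewrite mean_eps_eta subrr ma_coef0 mulr1 gt_eqF.
- move=> i j ij; rewrite mean_eps_eta.
  have -> : - j%:Z - - i%:Z = i%:Z - j%:Z - 0%:Z by ring.
  by rewrite ma_coef_past ?mulr0// addn0.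
Qed.

(** Differencing subtracts an older value of the process, so that the
    innovation eta_(-i) still enters the i-th variable with coefficient 1 and
    the later ones with coefficient 0. *)
Lemma diff_autocov_unitmx (r : nat) : (0 < r)%N ->
  \matrix_(i < p, j < p) diff_autocov autocov r (i%:Z - j%:Z) \in unitmx.
Proof.
move=> r0.
have L1ee s t : L1 P (fun w => eps s w * eps t w) by apply: L2M; exact: L2_eps.
have L1eZ s i : L1 P (fun w => eps s w * past_innovation i w).
  by apply: L2M => //; exact: L2_eps.
have DZ (i j : 'I_p) :
    mean P (fun w => lag_difference eps r (- j%:Z) w * past_innovation i w) =
    nu ^+ 2 * (c (i%:Z - j%:Z) - c (i%:Z - j%:Z - r%:Z)).
  under eq_fun do rewrite mulrBl.
  rewrite meanB// !mean_eps_eta mulrBr.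
  have -> : - j%:Z - - i%:Z = i%:Z - j%:Z by ring.
  by have -> : - j%:Z - r%:Z - - i%:Z = i%:Z - j%:Z - r%:Z by ring.
apply: (@gram_unitmx _ _ _ P _ (fun i => lag_difference eps r (- i%:Z)) past_innovation) => //.
- by move=> i; apply: L2B; exact: L2_eps.
- move=> i j; rewrite mxE.
  have E w : lag_difference eps r (- i%:Z) w * lag_difference eps r (- j%:Z) w =
      (eps (- i%:Z) w * eps (- j%:Z) w
       + eps (- i%:Z - r%:Z) w * eps (- j%:Z - r%:Z) w)
      - (eps (- i%:Z) w * eps (- j%:Z - r%:Z) w
         + eps (- i%:Z - r%:Z) w * eps (- j%:Z) w).
    by rewrite /lag_difference; ring.
  under eq_fun do rewrite E.
  rewrite meanB; [|exact: L1D..]; rewrite meanD// meanD// !mean_epsM /diff_autocov.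
  have -> : - j%:Z - - i%:Z = i%:Z - j%:Z by ring.
  have -> : - j%:Z - r%:Z - (- i%:Z - r%:Z) = i%:Z - j%:Z by ring.
  have -> : - j%:Z - r%:Z - - i%:Z = i%:Z - j%:Z - r%:Z by ring.
  have -> : - j%:Z - (- i%:Z - r%:Z) = i%:Z - j%:Z + r%:Z by ring.
  ring.
- move=> i; rewrite DZ ma_coef_past; last by rewrite -[ltnLHS]addn0 ltn_add2l.
  by rewrite subrr ma_coef0 subr0 mulr1 gt_eqF.
- move=> i j ij; rewrite DZ ma_coef_past; last exact: ltn_addr.
  have -> : i%:Z - j%:Z = i%:Z - j%:Z - 0%:Z by ring.
  by rewrite ma_coef_past ?addn0// subrr mulr0.
Qed.

Lemma long_run_varianceE :
  long_run_variance eps = nu ^+ 2 / (1 - \sum_(j < p) a j 0) ^+ 2.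
Proof.
rewrite -(two_sided_sum_autocov rho01 autocovN yule_walker autocov_geometric ma_coef_geometric).
have covE l : fine (covariance P (eps 0) (eps l)) = autocov l.
  by rewrite covariance_eps.
rewrite /long_run_variance; under eq_fun do rewrite covE.
by under [X in _ + limn (series X)]eq_fun do rewrite covE.
Qed.

End process.

(** * Consistency at the parametric rate *)

(** The inverse is continuous off 0, and 0 is its own inverse. *)
Lemma measurable_inv {R : realType} : measurable_fun [set: R] (@GRing.inv R).
Proof.
have -> : @GRing.inv R = fun x => if x == 0 then 0 else x^-1.
  by apply/funext => x; case: eqP => [->|//]; rewrite invr0.
apply: measurable_fun_if => //.
  by apply: measurable_fun_eqr => //; exact: measurable_cst.
rewrite setTI (_ : _ @^-1` _ = [set x | x != 0]); last first.
  by apply/seteqP; split=> x /=; case: eqP.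
apply: open_continuous_measurable_fun; first exact: open_neq.
by move=> x /set_mem x0; exact: inv_continuous.
Qed.

Section consistency.
Context {d : measure_display} {Omega : measurableType d} {R : realType}.
Variable P : probability Omega R.
Implicit Types (X Y Z : nat -> Omega -> R) (x y z : R).

Definition rate (T : nat) : R := (Num.sqrt T%:R)^-1.

Lemma rate_ge0 T : 0 <= rate T.
Proof. by rewrite invr_ge0 sqrtr_ge0. Qed.

Lemma rate_gt0 T : (0 < T)%N -> 0 < rate T.
Proof. by move=> T0; rewrite invr_gt0 sqrtr_gt0 ltr0n. Qed.

Lemma rate_cvg : rate T @[T --> \oo] --> (0 : R).
Proof.
apply/cvgrPdist_le => e e0; near=> T.
have T0 : (0 < T)%N by near: T; exact: nbhs_infty_gt.
rewrite sub0r normrN ger0_norm ?rate_ge0// /rate.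
have s0 : 0 < Num.sqrt (T%:R : R) by rewrite sqrtr_gt0 ltr0n.
have h : e^-1 <= Num.sqrt T%:R.
  rewrite -ler_sqr ?nnegrE ?sqrtr_ge0 ?invr_ge0 ?(ltW e0)// sqr_sqrtr//.
  by near: T; exact: nbhs_infty_ger.
rewrite -[leRHS]invrK lef_pV2 ?posrE ?invr_gt0//.
Unshelve. all: by end_near. Qed.

Lemma rate_small (M e : R) : 0 < e -> \forall T \near \oo, M * rate T <= e.
Proof.
move=> e0; have : (M * rate T) @[T --> \oo] --> (M * 0).
  by apply: cvgM; [exact: cvg_cst|exact: rate_cvg].
rewrite mulr0 => /cvgr_le; exact.
Qed.

(** Measurability is part of the notion because the value of a measure on a
    non-measurable event is arbitrary, so that bounds in probability could not
    be transferred between events otherwise. *)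
Definition consistent X x : Prop :=
  (forall T, measurable_fun setT (X T)) /\
  bigO_p P (fun T w => X T w - x) rate.

(** The delta method without derivatives.  The hypothesis on Z is pointwise and
    only concerns outcomes where X and Y are near their limits, so that Z may
    have singularities elsewhere. *)
Lemma consistent_locally_lipschitz X Y Z x y z (L delta : R) : 0 < delta ->
  (forall T, measurable_fun setT (Z T)) ->
  (\forall T \near \oo, forall w, `|X T w - x| <= delta -> `|Y T w - y| <= delta ->
    `|Z T w - z| <= L * (`|X T w - x| + `|Y T w - y|)) ->
  consistent X x -> consistent Y y -> consistent Z z.
Proof.
move=> d0 mZ lip [mX oX] [mY oY]; split=> // e e0.
have e2 : 0 < e / 2 by rewrite divr_gt0.
have [M M0 HM] := oX _ e2; have [N N0 HN] := oY _ e2.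
exists (`|L| * (M + N) + 1); first by rewrite ltr_wpDl// mulr_ge0// addr_ge0 ?ltW.
have sM := rate_small M d0; have sN := rate_small N d0.
near=> T.
have T0 : (0 < T)%N by near: T; exact: nbhs_infty_gt.
have r0 := rate_gt0 T0.
pose U := [set w | M * rate T < `|X T w - x|].
pose V := [set w | N * rate T < `|Y T w - y|].
have mU : measurable U by apply: measurable_norm_gt; exact: measurable_funB.
have mV : measurable V by apply: measurable_norm_gt; exact: measurable_funB.
apply: (@le_lt_trans _ _ (P (U `|` V))).
  apply: le_measure.
  - by rewrite inE; apply: measurable_norm_gt; exact: measurable_funB.
  - by rewrite inE; exact: measurableU.
  move=> w /=; apply: contraPP => /not_orP[]; rewrite /U /V /= => /negP + /negP.
  rewrite -!leNgt => hX hY; apply/negP; rewrite -leNgt.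
  have h : `|Z T w - z| <= L * (`|X T w - x| + `|Y T w - y|).
    have lipT : forall w, `|X T w - x| <= delta -> `|Y T w - y| <= delta ->
      `|Z T w - z| <= L * (`|X T w - x| + `|Y T w - y|) by near: T.
    apply: lipT; first by apply: (le_trans hX); near: T.
    by apply: (le_trans hY); near: T.
  apply: (le_trans h); apply: (@le_trans _ _ (`|L| * (M * rate T + N * rate T))).
    apply: (@le_trans _ _ (`|L| * (`|X T w - x| + `|Y T w - y|))).
      by rewrite ler_wpM2r ?addr_ge0// ler_norm.
    by rewrite ler_wpM2l// lerD.
  by rewrite -mulrDl mulrA ler_wpM2r ?ltW// ltrDl.
apply: (le_lt_trans (measureU2 _ mU mV)).
have hU : (P U < (e / 2)%:E)%E by rewrite /U; near: T; exact: HM.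
have hV : (P V < (e / 2)%:E)%E by rewrite /V; near: T; exact: HN.
by rewrite [e]splitr EFinD; exact: lteD hU hV.
Unshelve. all: by end_near. Qed.

Lemma consistent_cst x : consistent (fun _ _ => x) x.
Proof.
split; first by move=> T; exact: measurable_cst.
move=> e e0; exists 1 => //; near=> T.
rewrite (_ : [set w | _] = set0) ?measure0 ?lte_fin//.
apply/seteqP; split=> // w /=; rewrite subrr normr0 => /lt_geF.
by rewrite mulr_ge0// rate_ge0.
Unshelve. all: by end_near. Qed.

Lemma consistentD X Y x y : consistent X x -> consistent Y y ->
  consistent (fun T w => X T w + Y T w) (x + y).
Proof.
move=> cX cY; apply: (consistent_locally_lipschitz (L := 1) ltr01 _ _ cX cY).
  by move=> T; apply: measurable_funD; [exact: cX.1|exact: cY.1].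
apply: nearW => T w _ _; rewrite mul1r (_ : _ - _ = (X T w - x) + (Y T w - y)); last by ring.
exact: ler_normD.
Qed.

Lemma consistentM X Y x y : consistent X x -> consistent Y y ->
  consistent (fun T w => X T w * Y T w) (x * y).
Proof.
move=> cX cY.
apply: (consistent_locally_lipschitz (L := 1 + `|x| + `|y|) ltr01 _ _ cX cY).
  by move=> T; apply: measurable_funM; [exact: cX.1|exact: cY.1].
apply: nearW => T w dX dY.
rewrite (_ : _ - _ = (X T w - x) * (Y T w - y) + x * (Y T w - y) + y * (X T w - x)); last by ring.
apply: le_trans (ler_normD _ _) _; apply: le_trans (lerD (ler_normD _ _) (lexx _)) _.
rewrite !normrM.
have := normr_ge0 (X T w - x); have := normr_ge0 (Y T w - y).
have := normr_ge0 x; have := normr_ge0 y; nra.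
Qed.

Lemma consistent_inv X x : x != 0 -> consistent X x ->
  consistent (fun T w => (X T w)^-1) x^-1.
Proof.
move=> x0 cX; have nx : 0 < `|x| by rewrite normr_gt0.
apply: (consistent_locally_lipschitz (L := 2 / `|x| ^+ 2) (delta := `|x| / 2) _ _ _ cX cX).
- by rewrite divr_gt0.
- by move=> T; apply: measurableT_comp; [exact: measurable_inv|exact: cX.1].
apply: nearW => T w dX _.
have hX : `|x| / 2 <= `|X T w|.
  have := ler_normD (X T w) (x - X T w); rewrite subrKC [`|x - _|]distrC; lra.
have X0 : X T w != 0 by rewrite -normr_gt0 (lt_le_trans _ hX)// divr_gt0.
have nX : 0 < `|X T w| by rewrite normr_gt0.
have -> : (X T w)^-1 - x^-1 = - (X T w - x) / (X T w * x).
  by field; rewrite X0 x0.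
rewrite normrM normrN normfV normrM mulrC.
apply: (@le_trans _ _ (2 / `|x| ^+ 2 * `|X T w - x|)); last first.
  by rewrite ler_wpM2l ?lerDl// divr_ge0// exprn_ge0.
rewrite ler_wpM2r// -[leRHS]invrK lef_pV2 ?posrE ?invr_gt0 ?divr_gt0 ?exprn_gt0 ?mulr_gt0//.
rewrite invf_div expr2 mulrAC ler_wpM2r//.
Qed.

(** The exceptional branch is taken only where Y is away from its limit. *)
Lemma consistent_if X Y Z x y : y != 0 -> consistent X x -> consistent Y y ->
  (forall T, measurable_fun setT (Z T)) ->
  consistent (fun T w => if Y T w == 0 then Z T w else X T w) x.
Proof.
move=> y0 cX cY mZ.
apply: (consistent_locally_lipschitz (L := 1) (delta := `|y| / 2) _ _ _ cX cY).
- by rewrite divr_gt0// normr_gt0.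
- move=> T; apply: measurable_fun_ifT => //; last exact: cX.1.
  by apply: measurable_fun_eqr; [exact: cY.1|exact: measurable_cst].
apply: nearW => T w _ dY; case: eqP dY => [->|_ _].
  rewrite sub0r normrN => h.
  by have y1 : 0 < `|y| by [rewrite normr_gt0]; exfalso; move: h y1; lra.
by rewrite mul1r lerDl.
Qed.

Lemma consistent_sum (I : Type) (r : seq I) (X : I -> nat -> Omega -> R) (x : I -> R) :
  (forall i, consistent (X i) (x i)) ->
  consistent (fun T w => \sum_(i <- r) X i T w) (\sum_(i <- r) x i).
Proof.
move=> H; elim: r => [|i r IH].
  rewrite big_nil (_ : (fun _ _ => _) = fun _ _ => 0); first exact: consistent_cst.
  by apply/funext => T; apply/funext => w; rewrite big_nil.
rewrite big_cons (_ : (fun _ _ => _) = fun T w => X i T w + \sum_(i <- r) X i T w).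
  exact: consistentD.
by apply/funext => T; apply/funext => w; rewrite big_cons.
Qed.

Lemma consistent_prod (I : Type) (r : seq I) (X : I -> nat -> Omega -> R) (x : I -> R) :
  (forall i, consistent (X i) (x i)) ->
  consistent (fun T w => \prod_(i <- r) X i T w) (\prod_(i <- r) x i).
Proof.
move=> H; elim: r => [|i r IH].
  rewrite big_nil (_ : (fun _ _ => _) = fun _ _ => 1); first exact: consistent_cst.
  by apply/funext => T; apply/funext => w; rewrite big_nil.
rewrite big_cons (_ : (fun _ _ => _) = fun T w => X i T w * \prod_(i <- r) X i T w).
  exact: consistentM.
by apply/funext => T; apply/funext => w; rewrite big_cons.
Qed.

Lemma consistentN X x : consistent X x -> consistent (fun T w => - X T w) (- x).
Proof.
move=> cX; rewrite -mulN1r (_ : (fun _ _ => _) = fun T w => -1 * X T w).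
  by apply: consistentM => //; exact: consistent_cst.
by apply/funext => T; apply/funext => w; rewrite mulN1r.
Qed.

Lemma consistentB X Y x y : consistent X x -> consistent Y y ->
  consistent (fun T w => X T w - Y T w) (x - y).
Proof. by move=> cX cY; apply: consistentD => //; exact: consistentN. Qed.

(** Markov's inequality. *)
Lemma consistent_of_mean X x (K : R) : (forall T, L1 P (X T)) ->
  (\forall T \near \oo, mean P (fun w => `|X T w - x|) <= K * rate T) ->
  consistent X x.
Proof.
move=> X1 HK; split=> [T|e e0]; first exact: L1_measurable.
have K0 : 0 < `|K| + 1 by rewrite ltr_wpDl.
exists (2 * (`|K| + 1) / e); first by rewrite divr_gt0// mulr_gt0.
near=> T.
have T0 : (0 < T)%N by near: T; exact: nbhs_infty_gt.
have r0 := rate_gt0 T0.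
have t0 : 0 < 2 * (`|K| + 1) / e * rate T by rewrite mulr_gt0// divr_gt0// mulr_gt0.
have hK : mean P (fun w => `|X T w - x|) <= K * rate T by near: T.
apply: le_lt_trans (markov_le t0 (L1B (X1 T) (L1_cst P x)) hK) _.
rewrite lte_fin ltr_pdivrMr// mulrA mulrCA mulfV ?gt_eqF// mulr1 ltr_pM2r//.
by have := ler_norm K; lra.
Unshelve. all: by end_near. Qed.

Lemma consistent_deterministic (u : nat -> R) x (K : R) :
  (\forall T \near \oo, `|u T - x| <= K * rate T) ->
  consistent (fun T _ => u T) x.
Proof.
move=> H; apply: (@consistent_of_mean _ _ K); first by move=> T; exact: L1_cst.
by apply: filterS H => T; rewrite mean_cst.
Qed.

Definition consistent_mx (m n : nat) (A : nat -> Omega -> 'M[R]_(m, n))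
    (A0 : 'M[R]_(m, n)) : Prop :=
  forall i j, consistent (fun T w => A T w i j) (A0 i j).

Lemma consistent_mulmx m n k (A : nat -> Omega -> 'M[R]_(m, n))
    (B : nat -> Omega -> 'M[R]_(n, k)) A0 B0 :
  consistent_mx A A0 -> consistent_mx B B0 ->
  consistent_mx (fun T w => A T w *m B T w) (A0 *m B0).
Proof.
move=> cA cB i j; rewrite mxE; under eq_fun do under eq_fun do rewrite mxE.
by apply: consistent_sum => l; apply: consistentM; [exact: cA|exact: cB].
Qed.

Lemma consistent_det n (A : nat -> Omega -> 'M[R]_n) A0 :
  consistent_mx A A0 -> consistent (fun T w => \det (A T w)) (\det A0).
Proof.
move=> cA; apply: consistent_sum => s; apply: consistentM; first exact: consistent_cst.
by apply: consistent_prod => i; exact: cA.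
Qed.

(** By Cramer's formula the entries of the inverse are rational functions of
    the entries; singular samples are absorbed by [consistent_if]. *)
Lemma consistent_invmx n (A : nat -> Omega -> 'M[R]_n) A0 : A0 \in unitmx ->
  consistent_mx A A0 -> consistent_mx (fun T w => invmx (A T w)) (invmx A0).
Proof.
move=> uA cA i j.
have dA : \det A0 != 0 by rewrite -unitfE -unitmxE.
have E : (fun T w => invmx (A T w) i j) = fun T w =>
    if \det (A T w) == 0 then A T w i j
    else (\det (A T w))^-1 * cofactor (A T w) j i.
  apply/funext => T; apply/funext => w; rewrite /invmx unitmxE unitfE.
  by case: eqP => //= _; rewrite !mxE.
have -> : invmx A0 i j = (\det A0)^-1 * cofactor A0 j i by rewrite /invmx uA !mxE.
rewrite E; apply: (consistent_if dA _ (consistent_det cA)); last first.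
  by move=> T; exact: (cA i j).1.
apply: consistentM; first exact: consistent_inv dA (consistent_det cA).
apply: consistentM; first exact: consistent_cst.
apply: consistent_det => k l; rewrite !mxE.
under eq_fun do under eq_fun do rewrite !mxE.
exact: cA.
Qed.

Lemma measurable_mx_norm (m n : nat) (A : Omega -> 'M[R]_(m, n)) :
  (forall i j, measurable_fun setT (fun w => A w i j)) ->
  measurable_fun setT (fun w => `|A w|).
Proof.
move=> mA; under eq_fun do rewrite /Num.norm /= mx_normrE.
elim: (index_enum _) => [|ij r IH].
  by under eq_fun do rewrite big_nil; exact: measurable_cst.
under eq_fun do rewrite big_cons.
by apply: measurable_maxr => //; apply: measurableT_comp => //; exact: mA.
Qed.

(** The norm of a matrix is at most the sum of the absolute values of its
    entries. *)
Lemma bigO_p_of_consistent_mx m n (A : nat -> Omega -> 'M[R]_(m, n)) A0 :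
  consistent_mx A A0 -> bigO_p P (fun T w => A T w - A0) rate.
Proof.
move=> cA.
pose S T w := \sum_(i < m) \sum_(j < n) `|A T w i j - A0 i j|.
have cS : consistent S 0.
  rewrite (_ : 0 = \sum_(i < m) \sum_(j < n) (0 : R)); last first.
    by rewrite big1// => i _; rewrite big1.
  apply: consistent_sum => i; apply: consistent_sum => j.
  apply: (consistent_locally_lipschitz (L := 1) ltr01 _ _ (cA i j) (cA i j)).
    move=> T; apply: measurableT_comp => //.
    by apply: measurable_funB => //; exact: (cA i j).1.
  by apply: nearW => T w _ _; rewrite subr0 normr_id mul1r lerDl.
have [mS oS] := cS.
move=> e /oS [M M0 HM]; exists M => //; apply: filterS HM => T; apply: le_lt_trans.
have mN : measurable_fun setT (fun w => `|A T w - A0|).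
  apply: measurable_mx_norm => i j.
  under eq_fun do rewrite !mxE.
  by apply: measurable_funB => //; exact: (cA i j).1.
apply: le_measure.
- rewrite inE (_ : [set w | _] = [set w | M * rate T < `| `|A T w - A0| |]).
    exact: measurable_norm_gt.
  by apply/seteqP; split=> w /=; rewrite normr_id.
- rewrite inE; apply: measurable_norm_gt.
  by apply: measurable_funB => //; exact: measurable_cst.
move=> w /= h; apply: lt_le_trans h _; rewrite subr0.
have S0 : 0 <= S T w by apply: sumr_ge0 => i _; apply: sumr_ge0 => j _.
rewrite ger0_norm// {1}/Num.norm /= mx_normrE.
apply/bigmax_leP; split=> // -[i j] _ /=; rewrite !mxE.
rewrite /S (bigD1 i)//= (bigD1 j)//= -addrA lerDl addr_ge0 ?sumr_ge0// => k _.
by rewrite sumr_ge0.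
Qed.

End consistency.

(** * Cross products of differenced observations *)

Section difference_products.
Context {d : measure_display} {Omega : measurableType d} {R : realType}.
Variable P : probability Omega R.
Variables (eps : int -> Omega -> R) (gam : int -> R) (v K : R).
Hypothesis L2_eps : forall t, L2 P (eps t).
Hypothesis eps_var : forall t, mean P (fun w => eps t w ^+ 2) = v.
Hypothesis K_ge0 : 0 <= K.
Hypothesis autocov_sum : forall (N : nat) (s s' : int),
  mean P (fun w => `|\sum_(t < N) (eps (s + t%:Z) w * eps (s' + t%:Z) w
                                   - gam (s' - s))|) <= K * Num.sqrt N%:R.

Lemma L2_lag_difference r t : L2 P (lag_difference eps r t).
Proof. exact: L2B. Qed.

Lemma v_ge0 : 0 <= v.
Proof. by rewrite -(eps_var 0); apply: mean_ge0 => w; exact: sqr_ge0. Qed.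

Lemma mean_norm_eps t : mean P (fun w => `|eps t w|) <= 2^-1 * (v + 1).
Proof.
have := mean_normM_le ltr01 (L2_eps t) (L2_cst P 1).
under eq_fun do rewrite mulr1.
by rewrite eps_var expr1n mean_cst invr1 !mul1r.
Qed.

Lemma mean_norm_lag_difference r t : mean P (fun w => `|lag_difference eps r t w|) <= v + 1.
Proof.
have := mean_normD (L2_L1 (L2_eps t)) (L1N (L2_L1 (L2_eps (t - r)))).
under [X in _ + mean _ X]eq_fun do rewrite normrN.
move=> /le_trans; apply.
have := mean_norm_eps t; have := mean_norm_eps (t - r); lra.
Qed.

(** The product of two differences expands into four products of values of the
    process, each with its own time shift; the bound on their sums is uniform
    in the shifts, hence in r. *)
Lemma mean_norm_diff_autocov_sum (r x y : int) (N : nat) :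
  mean P (fun w => `|\sum_(t < N)
    (lag_difference eps r (x + t%:Z) w * lag_difference eps r (y + t%:Z) w
     - diff_autocov gam r (y - x))|)
  <= 4 * K * Num.sqrt N%:R.
Proof.
pose F x y w := \sum_(t < N) (eps (x + t%:Z) w * eps (y + t%:Z) w - gam (y - x)).
have L1F x' y' : L1 P (F x' y').
  by apply: L1_sum => t; apply: L1B; [exact: L2M|exact: L1_cst].
have E w : \sum_(t < N) (lag_difference eps r (x + t%:Z) w * lag_difference eps r (y + t%:Z) w
      - diff_autocov gam r (y - x)) =
    (F x y w + F (x - r) (y - r) w) + ((-1) * F x (y - r) w + (-1) * F (x - r) y w).
  rewrite !mulr_sumr -!big_split /=; apply: eq_bigr => t _.
  rewrite /lag_difference /diff_autocov.
  have -> : x + t%:Z - r = x - r + t%:Z by ring.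
  have -> : y + t%:Z - r = y - r + t%:Z by ring.
  have -> : y - r - (x - r) = y - x by ring.
  have -> : y - r - x = y - x - r by ring.
  have -> : y - (x - r) = y - x + r by ring.
  ring.
under eq_fun do rewrite E.
have L1N' x' y' : L1 P (fun w => (-1) * F x' y' w) by exact: L1Z.
have h0 := mean_normD (L1D (L1F x y) (L1F (x - r) (y - r)))
  (L1D (L1N' x (y - r)) (L1N' (x - r) y)).
have h1 := mean_normD (L1F x y) (L1F (x - r) (y - r)).
have h2 := mean_normD (L1N' x (y - r)) (L1N' (x - r) y).
rewrite !mean_normZ// !normrN1 !mul1r in h2.
have k1 := autocov_sum N x y; have k2 := autocov_sum N (x - r) (y - r).
have k3 := autocov_sum N x (y - r); have k4 := autocov_sum N (x - r) y.
rewrite -/(F _ _) in k1 k2 k3 k4.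
apply: (le_trans h0); lra.
Qed.

Variables (m : R -> R) (C : R).
Hypothesis C_ge0 : 0 <= C.
Hypothesis m_lip : forall x y, 0 <= x <= 1 -> 0 <= y <= 1 ->
  `|m x - m y| <= C * `|x - y|.

Definition obs (T : nat) (w : Omega) (t : nat) : R :=
  m (t%:R / T%:R) + eps t%:Z w.

Definition trend_diff (T r t : nat) : R := m (t%:R / T%:R) - m ((t - r)%:R / T%:R).

Lemma lag_diff_obs T r t w : (r <= t)%N ->
  lag_diff (obs T w) r t = trend_diff T r t + lag_difference eps r t w.
Proof.
move=> rt; rewrite /lag_diff /obs /trend_diff /lag_difference subzn//; ring.
Qed.

Lemma trend_diff_le T r t : (r <= t)%N -> (t <= T)%N ->
  `|trend_diff T r t| <= C * (r%:R / T%:R).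
Proof.
move=> rt tT; have [T0|T0] := posnP T.
  have -> : t = 0%N by lia.
  by rewrite /trend_diff subrr normr0 mulr_ge0// divr_ge0.
have T0' : 0 < T%:R :> R by rewrite ltr0n.
have itv k : (k <= T)%N -> 0 <= (k%:R / T%:R : R) <= 1.
  by move=> kT; rewrite divr_ge0//= ler_pdivrMr// mul1r ler_nat.
apply: le_trans (m_lip (itv _ tT) (itv _ _)) _; first by lia.
rewrite ler_wpM2l// -mulrBl natrB// opprB addrC subrK normrM normfV !ger0_norm//.
Qed.

Definition cross_sum (T r s i j : nat) (w : Omega) : R :=
  \sum_(s <= t < T.+1) lag_diff (obs T w) r (t - i) * lag_diff (obs T w) r (t - j).

Lemma L2_obs T t : L2 P (fun w => obs T w t).
Proof. by apply: L2D => //; exact: L2_cst. Qed.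

Lemma L1_cross_sum T r s i j : L1 P (cross_sum T r s i j).
Proof. by apply: L1_sum => t; apply: L2M; apply: L2B; exact: L2_obs. Qed.

(** The trend enters a difference by at most C r / T.  Summed over at most T
    times, its products with the noise contribute O(r), and its products with
    itself O(r^2 / T), which is O(r) as well. *)
Lemma mean_cross_sum T r s i j : (0 < T)%N -> (r <= T)%N -> (s <= T.+1)%N ->
  (0 < s)%N -> (r + i <= s)%N -> (r + j <= s)%N ->
  mean P (fun w => `|cross_sum T r s i j w
                     - (T.+1 - s)%:R * diff_autocov gam r (i%:Z - j%:Z)|)
  <= 4 * K * Num.sqrt T%:R + (2 * C * (v + 1) + C ^+ 2) * r%:R.
Proof.
move=> T0 rT sT s0 ri rj; have T0' : (0 : R) < T%:R by rewrite ltr0n.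
set N := (T.+1 - s)%N; pose x : int := s%:Z - i%:Z; pose y : int := s%:Z - j%:Z.
pose A i t := trend_diff T r (t + s - i).
pose D1 (t : 'I_N) w := A i t * lag_difference eps r (y + t%:Z) w.
pose D2 (t : 'I_N) w := A j t * lag_difference eps r (x + t%:Z) w.
have hA k (t : 'I_N) : (r + k <= s)%N -> `|A k t| <= C * (r%:R / T%:R).
  by move=> rk; apply: trend_diff_le; have := ltn_ord t; rewrite /N; lia.
(* With t + s in place of t, the truncated subtractions are exact. *)
have E w : cross_sum T r s i j w - N%:R * diff_autocov gam r (i%:Z - j%:Z) =
    \sum_(t < N) (lag_difference eps r (x + t%:Z) w * lag_difference eps r (y + t%:Z) w
                  - diff_autocov gam r (y - x)) +
    (\sum_(t < N) (D1 t w + D2 t w) + \sum_(t < N) A i t * A j t).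
  have -> : N%:R * diff_autocov gam r (i%:Z - j%:Z) = \sum_(t < N) diff_autocov gam r (y - x).
    by rewrite sumr_const card_ord mulr_natl;
      congr (diff_autocov gam _ _ *+ _); rewrite /x /y; ring.
  rewrite /cross_sum -{1}[s]add0n big_addn big_mkord -/N -sumrB -!big_split /=.
  apply: eq_bigr => t _; rewrite !lag_diff_obs; [|lia..].
  have -> : (t + s - i)%N%:Z = x + t%:Z by rewrite /x; lia.
  have -> : (t + s - j)%N%:Z = y + t%:Z by rewrite /y; lia.
  rewrite /D1 /D2 /A; ring.
under eq_fun do rewrite E.
have L1d u k : L1 P (fun w => u * lag_difference eps r k w) by apply/L1Z/L2_L1/L2_lag_difference.
have L1D12 : L1 P (fun w => \sum_(t < N) (D1 t w + D2 t w)).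
  by apply: L1_sum => t; apply: L1D; exact: L1d.
have L1S : L1 P (fun w => \sum_(t < N)
    (lag_difference eps r (x + t%:Z) w * lag_difference eps r (y + t%:Z) w
     - diff_autocov gam r (y - x))).
  apply: L1_sum => t; apply: L1B; last exact: L1_cst.
  by apply: L2M; exact: L2_lag_difference.
have h0 := mean_normD L1S (L1D L1D12 (L1_cst P (\sum_(t < N) A i t * A j t))).
have h1 := mean_normD L1D12 (L1_cst P (\sum_(t < N) A i t * A j t)).
have h2 := mean_norm_diff_autocov_sum r x y N.
have sN : Num.sqrt N%:R <= Num.sqrt T%:R :> R.
  by rewrite ler_wsqrtr// ler_nat /N; lia.
have NT : N%:R <= T%:R :> R by rewrite ler_nat /N; lia.
have rT' : 0 <= r%:R / T%:R :> R by rewrite divr_ge0.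
have cr : 0 <= C * (r%:R / T%:R) by rewrite mulr_ge0.
have v1 : 0 <= v + 1 by rewrite addr_ge0// v_ge0.
have h3 : mean P (fun w => `|\sum_(t < N) (D1 t w + D2 t w)|) <=
    2 * C * (v + 1) * r%:R.
  apply: le_trans (mean_norm_sum _ _ _) _; first by move=> t; apply: L1D; exact: L1d.
  apply: (@le_trans _ _ (\sum_(t < N) 2 * (C * (r%:R / T%:R)) * (v + 1))).
    apply: ler_sum => t _; apply: le_trans (mean_normD (L1d _ _) (L1d _ _)) _.
    rewrite !mean_normZ; [|exact/L2_L1/L2_lag_difference..].
    have a1 := hA i t ri; have a2 := hA j t rj.
    have b1 := mean_norm_lag_difference r (y + t%:Z).
    have b2 := mean_norm_lag_difference r (x + t%:Z).
    have c1 := ler_pM (normr_ge0 _) (mean_ge0 P (fun w => normr_ge0 _)) a1 b1.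
    have c2 := ler_pM (normr_ge0 _) (mean_ge0 P (fun w => normr_ge0 _)) a2 b2.
    by apply: le_trans (lerD c1 c2) _; lra.
  rewrite sumr_const card_ord -[leLHS]mulr_natl.
  apply: (@le_trans _ _ (T%:R * (2 * (C * (r%:R / T%:R)) * (v + 1)))).
    by rewrite ler_wpM2r// mulr_ge0// mulr_ge0.
  by rewrite le_eqVlt; apply/orP; left; apply/eqP; field; rewrite gt_eqF.
have h4 : `|\sum_(t < N) A i t * A j t| <= C ^+ 2 * r%:R.
  apply: le_trans (ler_norm_sum _ _ _) _.
  apply: (@le_trans _ _ (\sum_(t < N) (C * (r%:R / T%:R)) * (C * (r%:R / T%:R)))).
    by apply: ler_sum => t _; rewrite normrM ler_pM// hA.
  rewrite sumr_const card_ord -[leLHS]mulr_natl.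
  apply: (@le_trans _ _ (T%:R * (C * (r%:R / T%:R) * (C * (r%:R / T%:R))))).
    by rewrite ler_wpM2r// mulr_ge0.
  have -> : T%:R * (C * (r%:R / T%:R) * (C * (r%:R / T%:R))) =
      C ^+ 2 * r%:R * (r%:R / T%:R) by field; rewrite gt_eqF.
  by rewrite ler_piMr ?mulr_ge0 ?sqr_ge0// ler_pdivrMr// mul1r ler_nat.
rewrite mean_cst in h1.
have h5 : 4 * K * Num.sqrt N%:R <= 4 * K * Num.sqrt T%:R.
  by rewrite ler_wpM2l// mulr_ge0.
apply: (le_trans h0); lra.
Qed.

(** Division by T instead of the number of summands changes the result by a
    relative error (r + c) / T, of order T^(-1/2). *)
Lemma consistent_cross_sum (r s : nat -> nat) (i j c : nat) (B K' g0 : R) :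
  0 <= B ->
  (\forall T \near \oo, (r T)%:R <= B * Num.sqrt T%:R) ->
  (\forall T \near \oo, (r T + i < s T)%N /\ (r T + j < s T)%N /\ (s T <= r T + c)%N) ->
  (\forall T \near \oo, `|diff_autocov gam (r T) (i%:Z - j%:Z) - g0| <= K' * rate T) ->
  consistent P (fun T w => T%:R^-1 * cross_sum T (r T) (s T) i j w) g0.
Proof.
move=> B0 hr hs hg.
pose L := 2 * C * (v + 1) + C ^+ 2.
have L0 : 0 <= L.
  by rewrite addr_ge0 ?sqr_ge0// mulr_ge0 ?addr_ge0 ?v_ge0// mulr_ge0.
apply: (@consistent_of_mean _ _ _ P _ _ (4 * K + L * B + (B + c%:R) * (`|g0| + `|K'|) + K')).
  by move=> T; apply/L1Z/L1_cross_sum.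
have small := rate_small (B + c%:R) (@ltr01 R).
near=> T.
have T0 : (0 < T)%N by near: T; exact: nbhs_infty_gt.
have T0' : (0 : R) < T%:R by rewrite ltr0n.
have st0 : 0 < Num.sqrt (T%:R : R) by rewrite sqrtr_gt0.
have st1 : 1 <= Num.sqrt (T%:R : R) by rewrite -[leLHS]sqrtr1 ler_wsqrtr// ler1n.
have stE : Num.sqrt (T%:R : R) * Num.sqrt T%:R = T%:R by rewrite -expr2 sqr_sqrtr.
have hrT : (r T)%:R <= B * Num.sqrt T%:R by near: T.
have [hs1 [hs2 hs3]] : (r T + i < s T)%N /\ (r T + j < s T)%N /\ (s T <= r T + c)%N.
  by near: T.
have hgT : `|diff_autocov gam (r T) (i%:Z - j%:Z) - g0| <= K' * rate T by near: T.
have hsm : (B + c%:R) * rate T <= 1 by near: T.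
have hrc : (r T)%:R + c%:R <= (B + c%:R) * Num.sqrt T%:R.
  by rewrite mulrDl lerD// ler_peMr.
have rcT : (r T + c <= T)%N.
  rewrite -(ler_nat R) natrD; apply: (le_trans hrc).
  move: hsm; rewrite /rate ler_pdivrMr// mul1r => h.
  by rewrite -[leRHS]stE ler_wpM2r ?sqrtr_ge0.
have p1 : (r T <= T)%N by exact: leq_trans (leq_addr _ _) rcT.
have p2 : (s T <= T.+1)%N by exact: leq_trans hs3 (leqW rcT).
have p3 : (0 < s T)%N by exact: leq_trans hs1.
have H := mean_cross_sum T0 p1 p2 p3 (ltnW hs1) (ltnW hs2).
set S := cross_sum T (r T) (s T) i j in H *.
set g := diff_autocov gam (r T) (i%:Z - j%:Z) in H hgT *.
have E w : T%:R^-1 * S w - g0 = T%:R^-1 * (S w - (T.+1 - s T)%:R * g) +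
    (((T.+1 - s T)%:R / T%:R - 1) * g + (g - g0)).
  by field; rewrite gt_eqF.
under eq_fun do rewrite E.
have L1S : L1 P (fun w => S w - (T.+1 - s T)%:R * g).
  by apply: L1B; [exact: L1_cross_sum|exact: L1_cst].
apply: le_trans (mean_normD (L1Z _ L1S) (L1_cst P _)) _.
rewrite mean_normZ// mean_cst ger0_norm ?invr_ge0//.
have rT1 : (T%:R : R)^-1 * Num.sqrt (T%:R : R) = rate T.
  by rewrite /rate -{1}stE invfM mulfVK// gt_eqF.
have h1 : T%:R^-1 * mean P (fun w => `|S w - (T.+1 - s T)%:R * g|) <= (4 * K + L * B) * rate T.
  rewrite -rT1 mulrCA ler_wpM2l ?invr_ge0//; apply: (le_trans H).
  by rewrite -/L [leRHS]mulrDl lerD2l -[leRHS]mulrA ler_wpM2l.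
have r0 : 0 <= rate T :> R by exact: rate_ge0.
have r1 : rate T <= 1 :> R by rewrite /rate invf_le1.
have hg1 : `|g| <= `|g0| + `|K'|.
  rewrite -[g](subrK g0) addrC; apply: le_trans (ler_normD _ _) _; rewrite lerD2l.
  apply: (le_trans hgT); apply: (@le_trans _ _ (`|K'| * rate T)).
    by rewrite ler_wpM2r// ler_norm.
  by rewrite ler_piMr.
have h2 : `|(T.+1 - s T)%:R / T%:R - 1| <= (B + c%:R) * rate T :> R.
  have -> : (T.+1 - s T)%:R / T%:R - 1 = - (T%:R^-1 * (s T - 1)%:R) :> R.
    rewrite (natrB _ p2) (natrB _ p3).
    by rewrite -natr1; field; rewrite gt_eqF.
  rewrite normrN ger0_norm ?mulr_ge0 ?invr_ge0//.
  rewrite -rT1 mulrCA ler_wpM2l ?invr_ge0//; apply: le_trans hrc.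
  by rewrite -natrD ler_nat (leq_trans (leq_subr _ _) hs3).
have h3 : `|((T.+1 - s T)%:R / T%:R - 1) * g| <= (B + c%:R) * rate T * (`|g0| + `|K'|).
  by rewrite normrM ler_pM.
apply: le_trans (lerD h1 (le_trans (ler_normD _ _) (lerD h3 hgT))) _.
by rewrite le_eqVlt; apply/orP; left; apply/eqP; ring.
Unshelve. all: by end_near. Qed.

End difference_products.

(** * The autoregressive filter applied to autocovariances of differences *)

Section filter_algebra.
Context {R : realType}.
Variables (p : nat) (a : 'cV[R]_p).
Local Notation c := (ma_coef a).

(** The coefficients 1, -a_1, ..., -a_p of the autoregressive polynomial. *)
Definition ar_coef (b : 'cV[R]_p) (k : 'I_p.+1) : R :=
  if unlift ord0 k is Some j then - b j 0 else 1.

Lemma ar_coef_sum (b : 'cV[R]_p) (f : nat -> R) :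
  \sum_(k < p.+1) ar_coef b k * f k = f 0%N - \sum_(j < p) b j 0 * f j.+1.
Proof.
rewrite big_ord_recl /ar_coef unlift_none mul1r -sumrN; congr (_ + _).
by apply: eq_bigr => j _; rewrite liftK mulNr.
Qed.

Lemma ar_coef_ma (x : int) :
  \sum_(k < p.+1) ar_coef a k * c (x - k%:Z) = (x == 0)%:R.
Proof.
rewrite (ar_coef_sum a (fun k => c (x - k%:Z))) subr0.
case: x => [n|n].
  by rewrite ma_coef_rec eqz_nat; case: n.
rewrite ma_coef_lt0// big1 ?subr0// => j _.
by rewrite ma_coef_lt0 ?mulr0//; lia.
Qed.

Variables (nu : R) (g : int -> R).
Hypothesis gN : forall h, g (- h) = g h.
Hypothesis g_yw : forall h,
  g h - \sum_(j < p) a j 0 * g (h - j.+1%:Z) = nu ^+ 2 * c (- h).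

Lemma diff_autocovN r h : diff_autocov g r (- h) = diff_autocov g r h.
Proof.
rewrite /diff_autocov gN -(gN (- h - r)) -(gN (- h + r)).
have -> : - (- h - r) = h + r by ring.
have -> : - (- h + r) = h - r by ring.
ring.
Qed.

(** Three instances of the Yule-Walker equation, at h, h - r and h + r. *)
Lemma diff_autocov_filter (r h : int) :
  diff_autocov g r h - \sum_(j < p) a j 0 * diff_autocov g r (h - j.+1%:Z) =
  nu ^+ 2 * (2 * c (- h) - c (r - h) - c (- r - h)).
Proof.
have e1 := g_yw h; have e2 := g_yw (h - r); have e3 := g_yw (h + r).
have -> : r - h = - (h - r) by ring.
have -> : - r - h = - (h + r) by ring.
rewrite !mulrBr mulrCA -e1 -e2 -e3.
have -> : \sum_(j < p) a j 0 * diff_autocov g r (h - j.+1%:Z) =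
    2 * (\sum_(j < p) a j 0 * g (h - j.+1%:Z)) -
    \sum_(j < p) a j 0 * g (h - r - j.+1%:Z) -
    \sum_(j < p) a j 0 * g (h + r - j.+1%:Z).
  rewrite mulr_sumr -!sumrB; apply: eq_bigr => j _; rewrite /diff_autocov.
  have -> : h - j.+1%:Z - r = h - r - j.+1%:Z by ring.
  have -> : h - j.+1%:Z + r = h + r - j.+1%:Z by ring.
  ring.
rewrite /diff_autocov; ring.
Qed.

(** The left-hand side is the variance of the filtered difference of order 1,
    that is of eta_t - eta_(t-1).  Filtering in one index leaves a combination
    of shifted copies of c, and filtering in the other turns each copy into a
    unit impulse. *)
Lemma differenced_innov_var :
  \sum_(k < p.+1) \sum_(l < p.+1)
    ar_coef a k * ar_coef a l * diff_autocov g 1 (k%:Z - l%:Z) = 2 * nu ^+ 2.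
Proof.
under eq_bigr => k _.
  under eq_bigr do rewrite -mulrA.
  rewrite -mulr_sumr (ar_coef_sum a (fun l => diff_autocov g 1 (k%:Z - l%:Z))) subr0.
  rewrite diff_autocov_filter.
  rewrite (_ : _ * _ = nu ^+ 2 * (2 * (ar_coef a k * c (0 - k%:Z)) -
    ar_coef a k * c (1 - k%:Z) - ar_coef a k * c (- 1 - k%:Z))); last by rewrite sub0r; ring.
  over.
rewrite -mulr_sumr !sumrB -mulr_sumr !ar_coef_ma /=; ring.
Qed.

(** Of the three terms on the right-hand side of [diff_autocov_filter] only
    c(r - h) survives at the positive lags h = i + 1. *)
Lemma diff_yule_walker (r : nat) (i : 'I_p) : (0 < r)%N ->
  \sum_(j < p) diff_autocov g r (i%:Z - j%:Z) * a j 0 =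
  diff_autocov g r i.+1%:Z + nu ^+ 2 * c (r%:Z - i.+1%:Z).
Proof.
move=> r0; have := diff_autocov_filter r i.+1%:Z.
rewrite ma_coef_neg (_ : c (- r%:Z - _) = 0); last by rewrite ma_coef_lt0//; lia.
rewrite mulr0 sub0r subr0 mulrN => /eqP; rewrite subr_eq => /eqP ->.
rewrite addrAC addNr add0r.
by apply: eq_bigr => j _; rewrite mulrC; congr (_ * diff_autocov _ _ _); lia.
Qed.

Lemma plain_yule_walker (i : 'I_p) :
  \sum_(j < p) g (i%:Z - j%:Z) * a j 0 = g i.+1%:Z.
Proof.
have := g_yw i.+1%:Z; rewrite ma_coef_neg mulr0 => /eqP; rewrite subr_eq0 => /eqP ->.
by apply: eq_bigr => j _; rewrite mulrC; congr (_ * g _); lia.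
Qed.

End filter_algebra.

(** * Consistency of the estimators *)

Section estimators_consistency.
Context {d : measure_display} {Omega : measurableType d} {R : realType}.
Variable P : probability Omega R.
Variables (p : nat) (a : 'cV[R]_p).

(** Each coefficient is a polynomial in the entries of the vector. *)
Lemma consistent_ma_coef (b : nat -> Omega -> 'cV[R]_p) (k : int) :
  consistent_mx P b a -> consistent P (fun T w => ma_coef (b T w) k) (ma_coef a k).
Proof.
move=> cb; case: k => n; last by rewrite /=; exact: consistent_cst.
elim/ltn_ind: n => -[_|n IH]; first exact: consistent_cst.
rewrite ma_coefS; under eq_fun do under eq_fun do rewrite ma_coefS.
apply: consistent_sum => j; apply: consistentM; first exact: cb.
have [jn|nj] := leqP j n; last first.
  have E (b' : 'cV[R]_p) : ma_coef b' (n.+1%:Z - j.+1%:Z) = 0 by rewrite ma_coef_lt0//; lia.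
  by rewrite E; under eq_fun do under eq_fun do rewrite E; exact: consistent_cst.
have -> : n.+1%:Z - j.+1%:Z = (n - j)%N by lia.
by apply: IH; lia.
Qed.

Lemma consistent_Gamma_hat (Y : nat -> Omega -> nat -> R) (r : nat -> nat) (g : int -> R) :
  (forall h, g (- h) = g h) ->
  (forall l, consistent P (fun T w => autocov_hat_nat T (Y T w) (r T) l) (g l%:Z)) ->
  consistent_mx P (fun T w => Gamma_hat p T (Y T w) (r T))
    (\matrix_(i, j) g (i%:Z - j%:Z)) /\
  consistent_mx P (fun T w => gamma_hat p T (Y T w) (r T)) (\col_i g i.+1%:Z).
Proof.
move=> gN H; have gabs h : g h = g `|h|%N by case: h => // n; rewrite NegzE gN.
split=> i j; rewrite !mxE; under eq_fun do under eq_fun do rewrite mxE.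
  by rewrite gabs; exact: H.
exact: H.
Qed.

(** The residual sum of squares is a quadratic form in the coefficients, whose
    matrix consists of statistics that do not depend on the estimator. *)
Lemma innov_varE (T : nat) (y : nat -> R) (b : 'cV[R]_p) :
  innov_var T y b = 2^-1 * \sum_(k < p.+1) \sum_(l < p.+1)
    ar_coef b k * ar_coef b l *
    (T%:R^-1 * \sum_(p + 2 <= t < T.+1) lag_diff y 1 (t - k) * lag_diff y 1 (t - l)).
Proof.
rewrite /innov_var invfM -mulrA; congr (_ * _).
have resE t : residual y b t = \sum_(k < p.+1) ar_coef b k * lag_diff y 1 (t - k).
  by rewrite (ar_coef_sum b (fun k => lag_diff y 1 (t - k))) subn0.
transitivity (T%:R^-1 * \sum_(p + 2 <= t < T.+1) \sum_(k < p.+1) \sum_(l < p.+1)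
    ar_coef b k * ar_coef b l * (lag_diff y 1 (t - k) * lag_diff y 1 (t - l))).
  congr (_ * _); apply: eq_bigr => t _; rewrite resE expr2 mulr_suml.
  apply: eq_bigr => k _; rewrite mulr_sumr; apply: eq_bigr => l _.
  by rewrite mulrACA.
rewrite exchange_big mulr_sumr; apply: eq_bigr => k _.
rewrite exchange_big mulr_sumr; apply: eq_bigr => l _.
by rewrite -mulr_sumr mulrCA.
Qed.

Lemma consistent_ar_coef (b : nat -> Omega -> 'cV[R]_p) k :
  consistent_mx P b a -> consistent P (fun T w => ar_coef (b T w) k) (ar_coef a k).
Proof.
move=> cb; rewrite /ar_coef; case: (unlift ord0 k) => [j|]; last exact: consistent_cst.
by apply: consistentN; exact: cb.
Qed.

Variables (Y : nat -> Omega -> nat -> R) (q : nat -> nat) (g : int -> R) (nu : R).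
Hypothesis gN : forall h, g (- h) = g h.
Hypothesis g_yw : forall h,
  g h - \sum_(j < p) a j 0 * g (h - j.+1%:Z) = nu ^+ 2 * ma_coef a (- h).
Hypothesis autocov_q : forall l,
  consistent P (fun T w => autocov_hat_nat T (Y T w) (q T) l) (2 * g l%:Z).
Hypothesis autocov_fixed : forall r l, (0 < r)%N ->
  consistent P (fun T w => autocov_hat_nat T (Y T w) r l) (diff_autocov g r l).
Hypothesis cross_fixed : forall k l : nat, (k <= p)%N -> (l <= p)%N ->
  consistent P (fun T w => T%:R^-1 * \sum_(p + 2 <= t < T.+1)
    lag_diff (Y T w) 1 (t - k) * lag_diff (Y T w) 1 (t - l))
  (diff_autocov g 1 (k%:Z - l%:Z)).
Hypothesis autocov_unit : \matrix_(i < p, j < p) g (i%:Z - j%:Z) \in unitmx.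
Hypothesis diff_autocov_unit : forall r : nat, (0 < r)%N ->
  \matrix_(i < p, j < p) diff_autocov g r (i%:Z - j%:Z) \in unitmx.
Hypothesis A1_neq0 : 1 - \sum_(j < p) a j 0 != 0.

Lemma consistent_a_pilot : consistent_mx P (fun T w => a_pilot p T (Y T w) (q T)) a.
Proof.
have [cG cg] := consistent_Gamma_hat (g := fun h => 2 * g h)
  (fun h => congr1 (fun x => 2 * x) (gN h)) autocov_q.
set G := \matrix_(_, _) _ in cG; set v := \col_ _ _ in cg.
have GE : G = 2 *: \matrix_(i < p, j < p) g (i%:Z - j%:Z).
  by apply/matrixP => i j; rewrite !mxE.
have uG : G \in unitmx by rewrite GE unitmxZ// unitfE.
suff <- : invmx G *m v = a by exact: consistent_mulmx (consistent_invmx uG cG) cg.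
apply: (canLR (mulKmx uG)); apply/colP => i; rewrite !mxE.
under eq_bigr do rewrite mxE -mulrA.
by rewrite -mulr_sumr (plain_yule_walker g_yw).
Qed.

(** The limit of the quadratic form is half the variance of
    eta_t - eta_(t-1). *)
Lemma consistent_innov_var (b : nat -> Omega -> 'cV[R]_p) : consistent_mx P b a ->
  consistent P (fun T w => innov_var T (Y T w) (b T w)) (nu ^+ 2).
Proof.
move=> cb; under eq_fun do under eq_fun do rewrite innov_varE.
have -> : nu ^+ 2 = 2^-1 * \sum_(k < p.+1) \sum_(l < p.+1)
    ar_coef a k * ar_coef a l * diff_autocov g 1 (k%:Z - l%:Z).
  by rewrite (differenced_innov_var g_yw); field.
apply: consistentM; first exact: consistent_cst.
apply: consistent_sum => k; apply: consistent_sum => l.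
apply: consistentM; first by apply: consistentM; exact: consistent_ar_coef.
by apply: cross_fixed; rewrite -ltnS.
Qed.

Lemma consistent_a_second r : (0 < r)%N ->
  consistent_mx P (fun T w => a_second p T (Y T w) (q T) r) a.
Proof.
move=> r0.
have [cG cg] := consistent_Gamma_hat (r := fun=> r) (diff_autocovN gN r%:Z)
  (fun l => autocov_fixed l r0).
have uG := diff_autocov_unit r0.
set G := \matrix_(_, _) _ in cG uG; set v := \col_ _ _ in cg.
suff <- : invmx G *m (v + nu ^+ 2 *: ma_vec a r) = a.
  apply: consistent_mulmx; first exact: consistent_invmx uG cG.
  move=> i j; rewrite !mxE; under eq_fun do under eq_fun do rewrite !mxE.
  apply: consistentD.
    by have := cg i j; rewrite mxE; under eq_fun do under eq_fun do rewrite mxE.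
  apply: consistentM.
    by apply: consistent_innov_var; exact: consistent_a_pilot.
  by apply: consistent_ma_coef; exact: consistent_a_pilot.
apply: (canLR (mulKmx uG)); apply/colP => i; rewrite !mxE.
under eq_bigr do rewrite mxE.
by rewrite (diff_yule_walker g_yw).
Qed.

Lemma consistent_a_hat rbar : (0 < rbar)%N ->
  consistent_mx P (fun T w => a_hat p T (Y T w) (q T) rbar) a.
Proof.
move=> r0 i j.
have -> : a i j = rbar%:R^-1 * \sum_(0 <= r < rbar) a i j.
  by rewrite sumr_const_nat subn0 -[X in _ * X]mulr_natl mulKf// pnatr_eq0 -lt0n.
under eq_fun do under eq_fun do rewrite mxE summxE big_add1 /=.
apply: consistentM; first exact: consistent_cst.
by apply: consistent_sum => r; exact: consistent_a_second.
Qed.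

Lemma consistent_sigma2_hat rbar : (0 < rbar)%N ->
  consistent P (fun T w => sigma2_hat p T (Y T w) (q T) rbar)
    (nu ^+ 2 / (1 - \sum_(j < p) a j 0) ^+ 2).
Proof.
move=> r0; have ca := consistent_a_hat r0.
have cA : consistent P (fun T w => 1 - \sum_(j < p) a_hat p T (Y T w) (q T) rbar j 0)
    (1 - \sum_(j < p) a j 0).
  apply: consistentB; first exact: consistent_cst.
  by apply: consistent_sum => j; exact: ca.
apply: consistentM; first exact: consistent_innov_var.
apply: consistent_inv; first by rewrite expf_neq0.
under eq_fun do under eq_fun do rewrite expr2; rewrite expr2.
exact: consistentM.
Qed.

End estimators_consistency.

(** * Growing lags *)

Section lag_sequences.
Context {R : realType}.
Variable q : nat -> nat.

Lemma lag_le_sqrt :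
  (q T)%:R / Num.sqrt (T%:R : R) @[T --> \oo] --> (0 : R) ->
  \forall T \near \oo, (q T)%:R <= 1 * Num.sqrt (T%:R : R).
Proof.
move=> /cvgr_le H; near=> T.
have T0 : (0 < T)%N by near: T; exact: nbhs_infty_gt.
rewrite -ler_pdivrMr ?sqrtr_gt0 ?ltr0n//.
by near: T; apply: H; exact: ltr01.
Unshelve. all: by end_near. Qed.

(** Taking logarithms, the claim is q_T >= log T / (2 |log rho|). *)
Lemma geometric_le_rate (rho : R) : 0 < rho < 1 ->
  (q T)%:R / ln (T%:R : R) @[T --> \oo] --> +oo ->
  \forall T \near \oo, rho ^+ q T <= rate T :> R.
Proof.
move=> /andP[r0 r1] H.
have l0 : ln rho < 0 by rewrite ln_lt0// r0.
pose A := (- (2 * ln rho))^-1.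
have HA : \forall T \near \oo, A <= (q T)%:R / ln (T%:R : R).
  by have /cvgryPge := H; exact.
near=> T.
have T1 : (1 < T)%N by near: T; exact: nbhs_infty_gt.
have T0' : (0 : R) < T%:R by rewrite ltr0n ltnW.
have lT : 0 < ln (T%:R : R) by rewrite ln_gt0// ltr1n.
have hA : A <= (q T)%:R / ln (T%:R : R) by near: T.
have h : - ln (T%:R : R) >= 2 * (q T)%:R * ln rho.
  move: hA; rewrite ler_pdivlMr// /A mulrC ler_pdivrMr; last by rewrite oppr_gt0; lra.
  lra.
have h2 : (rho ^+ q T) ^+ 2 <= (rate T) ^+ 2.
  rewrite /rate exprVn sqr_sqrtr ?(ltW T0')// -exprM.
  have -> : rho ^+ (q T * 2) = expR ((q T * 2)%:R * ln rho).
    by rewrite expRM_natl lnK.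
  have -> : (T%:R : R)^-1 = expR (- ln (T%:R : R)) by rewrite expRN lnK.
  by rewrite ler_expR natrM; lra.
by rewrite -ler_sqr ?nnegrE ?exprn_ge0 ?rate_ge0 ?(ltW r0).
Unshelve. all: by end_near. Qed.

End lag_sequences.

(** * Sample autocovariances of differences *)

Section autocov_consistency.
Context {d : measure_display} {Omega : measurableType d} {R : realType}.
Variable P : probability Omega R.

(** The error is r / (T - r), which is at most 2 r / T once r <= T / 2. *)
Lemma consistent_normalizer (r : nat -> nat) (B : R) : 0 <= B ->
  (\forall T \near \oo, (r T)%:R <= B * Num.sqrt (T%:R : R)) ->
  consistent P (fun T _ => T%:R / (T%:R - (r T)%:R)) 1.
Proof.
move=> B0 hr; apply: (@consistent_deterministic _ _ _ P _ _ (2 * B)).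
have small := rate_small (2 * B) (@ltr01 R).
near=> T.
have T0 : (0 < T)%N by near: T; exact: nbhs_infty_gt.
have T0' : (0 : R) < T%:R by rewrite ltr0n.
have st0 : 0 < Num.sqrt (T%:R : R) by rewrite sqrtr_gt0.
have stE : Num.sqrt (T%:R : R) * Num.sqrt T%:R = T%:R by rewrite -expr2 sqr_sqrtr ?(ltW T0').
have hrT : (r T)%:R <= B * Num.sqrt (T%:R : R) by near: T.
have h2 : 2 * B * Num.sqrt (T%:R : R) <= T%:R.
  have : 2 * B * rate T <= 1 by near: T.
  rewrite /rate ler_pdivrMr// mul1r => h.
  by rewrite -[leRHS]stE ler_wpM2r ?sqrtr_ge0.
have d0 : T%:R / 2 <= T%:R - (r T)%:R :> R by lra.
have d1 : 0 < T%:R - (r T)%:R :> R by lra.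
have -> : T%:R / (T%:R - (r T)%:R) - 1 = (r T)%:R / (T%:R - (r T)%:R) :> R.
  by field; rewrite gt_eqF.
rewrite ger0_norm; last by rewrite divr_ge0// ltW.
rewrite ler_pdivrMr// /rate mulrAC ler_pdivlMr//.
apply: le_trans (ler_wpM2r (ltW st0) hrT) _.
rewrite -mulrA stE; apply: (@le_trans _ _ (2 * B * (T%:R / 2))); first by lra.
by rewrite ler_wpM2l// mulr_ge0.
Unshelve. all: by end_near. Qed.

Variables (eps : int -> Omega -> R) (gam : int -> R) (v K : R).
Hypothesis L2_eps : forall t, L2 P (eps t).
Hypothesis eps_var : forall t, mean P (fun w => eps t w ^+ 2) = v.
Hypothesis K_ge0 : 0 <= K.
Hypothesis autocov_sum : forall (N : nat) (s s' : int),
  mean P (fun w => `|\sum_(t < N) (eps (s + t%:Z) w * eps (s' + t%:Z) w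
                                   - gam (s' - s))|) <= K * Num.sqrt N%:R.
Hypothesis gamN : forall h, gam (- h) = gam h.
Variables (m : R -> R) (C : R).
Hypothesis C_ge0 : 0 <= C.
Hypothesis m_lip : forall x y, 0 <= x <= 1 -> 0 <= y <= 1 ->
  `|m x - m y| <= C * `|x - y|.

Let Y := obs eps m.

Lemma consistent_autocov_hat (r : nat -> nat) (l : nat) (B K' g0 : R) : 0 <= B ->
  (\forall T \near \oo, (r T)%:R <= B * Num.sqrt (T%:R : R)) ->
  (\forall T \near \oo, `|diff_autocov gam (r T) l - g0| <= K' * rate T) ->
  consistent P (fun T w => autocov_hat_nat T (Y T w) (r T) l) g0.
Proof.
move=> B0 hr hg.
have E T w : autocov_hat_nat T (Y T w) (r T) l =
    T%:R / (T%:R - (r T)%:R) *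
    (T%:R^-1 * cross_sum eps m T (r T) (r T + l + 1) 0 l w).
  rewrite /autocov_hat_nat /cross_sum; under [X in _ = _ * (_ * X)]eq_bigr do rewrite subn0.
  (* For T = 0 both sums are empty. *)
  have [->|T0] := posnP T; first by rewrite !big_geq ?mulr0//; lia.
  by rewrite mulrA; congr (_ * _); rewrite mulrAC mulfV ?mul1r// pnatr_eq0 -lt0n.
under eq_fun do under eq_fun do rewrite E.
rewrite -[g0]mul1r; apply: consistentM; first exact: consistent_normalizer hr.
apply: (consistent_cross_sum L2_eps eps_var K_ge0 autocov_sum C_ge0 m_lip
  (c := l.+1) (B := B) (K' := K')) => //.
  by apply: nearW => T; lia.
by apply: filterS hg => T; rewrite sub0r diff_autocovN.
Qed.

End autocov_consistency.

(** The lags l - q and l + q both have absolute value at least q - l. *)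
Lemma diff_autocov_large_lag {R : realType} (g : int -> R) (rho K : R) (q : nat -> nat) (l : nat) :
  0 < rho < 1 -> 0 <= K -> (forall h, g (- h) = g h) ->
  (forall h : nat, `|g h%:Z| <= K * rho ^+ h) ->
  q @ \oo --> \oo ->
  (\forall T \near \oo, rho ^+ q T <= rate T :> R) ->
  \forall T \near \oo, `|diff_autocov g (q T) l - 2 * g l| <= 2 * K / rho ^+ l * rate T.
Proof.
move=> /andP[r0 r1] K0 gN gK qoo hq.
have large : \forall T \near \oo, (l <= q T)%N by exact: (qoo _ (nbhs_infty_ge l)).
near=> T.
have lq : (l <= q T)%N by near: T.
have hqT : rho ^+ q T <= rate T by near: T.
have -> : diff_autocov g (q T) l - 2 * g l = - g (q T - l)%N - g (q T + l)%N.
  rewrite /diff_autocov -(gN (l%:Z - (q T)%:Z)).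
  have -> : - (l%:Z - (q T)%:Z) = (q T - l)%N by lia.
  have -> : l%:Z + (q T)%:Z = (q T + l)%N by lia.
  ring.
apply: le_trans (ler_normB _ _) _; rewrite normrN.
have rl : 0 < rho ^+ l by rewrite exprn_gt0.
have h1 : `|g (q T - l)%N| <= K / rho ^+ l * rate T.
  apply: le_trans (gK _) _; rewrite -mulrA ler_wpM2l//.
  by rewrite mulrC ler_pdivlMr// -exprD subnK.
have h2 : `|g (q T + l)%N| <= K / rho ^+ l * rate T.
  apply: le_trans (gK _) _; rewrite -mulrA ler_wpM2l//.
  rewrite mulrC ler_pdivlMr// -exprD; apply: le_trans hqT.
  by rewrite ler_wiXn2l ?(ltW r0) ?(ltW r1)//; lia.
by apply: le_trans (lerD h1 h2) _; lra.
Unshelve. all: by end_near. Qed.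

(** * The convergence rates *)

Theorem proposition4p1 (R : realType) (d : measure_display)
    (Omega : measurableType d) (P : probability Omega R)
    (p : nat) (a : 'cV[R]_p) (eps eta : int -> {RV P >-> R}) (nu : R)
    (m : R -> R) (q : nat -> nat) (rbar : nat)
    (eta_iid : iid eta)
    (eta_mean : forall t, ('E_P[eta t] = 0)%E)
    (eta_var : forall t, ('E_P[(fun w => eta t w ^+ 2)%R] = (nu ^+ 2)%:E)%E)
    (nu2_gt0 : 0 < nu ^+ 2)
    (eta_fourth : forall t, ('E_P[(fun w => eta t w ^+ 4)%R] < +oo)%E)
    (eps_stationary : stationary eps)
    (eps_ar : ar_equation a eps eta)
    (a_causal : causal a)
    (m_lipschitz : exists C : R, C.-lipschitz_`[0, 1] m)
    (rbar_ge1 : (1 <= rbar)%N)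
    (q_oo : q @ \oo --> \oo)
    (q_log : (q T)%:R / ln (T%:R : R) @[T --> \oo] --> +oo)
    (q_sqrt : (q T)%:R / Num.sqrt (T%:R : R) @[T --> \oo] --> (0 : R)) :
  let Y (T : nat) (w : Omega) (t : nat) : R :=
    m (t%:R / T%:R) + eps t%:Z w in
  let rate (T : nat) : R := (Num.sqrt T%:R)^-1 in
  [/\ bigO_p P (fun T w => a_pilot p T (Y T w) (q T) - a) rate,
      bigO_p P (fun T w => a_hat p T (Y T w) (q T) rbar - a) rate
    & bigO_p P (fun T w =>
        sigma2_hat p T (Y T w) (q T) rbar - long_run_variance eps) rate].
Proof.
move=> Y rt.
have [rho [rho01 rho_geo]] := int_recursion_geometric a_causal.
pose g := autocov eps.
have L2e := L2_eps eps_stationary.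
have epsM := mean_epsM eta_mean eta_fourth eps_stationary eps_ar a_causal.
have gN : forall h, g (- h) = g h.
  exact: autocovN eta_mean eta_fourth eps_stationary eps_ar a_causal.
have g_yw := yule_walker eta_iid eta_mean eta_var eta_fourth eps_stationary
  eps_ar a_causal rho01 rho_geo.
have g_geo := autocov_geometric eta_iid eta_mean eta_var eta_fourth eps_stationary
  eps_ar a_causal rho01 rho_geo.
have [K K0 HK] := mean_norm_autocov_sum eta_iid eta_mean eta_var eta_fourth eps_stationary
  eps_ar a_causal rho01 rho_geo.
have A1 := ar_polynomial1_neq0 a_causal.
have [C [C0 m_lip]] : exists C : R, 0 <= C /\ forall x y, 0 <= x <= 1 -> 0 <= y <= 1 ->
    `|m x - m y| <= C * `|x - y|.
  have [C HC] := m_lipschitz; exists `|C|; split=> // x y x01 y01.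
  apply: (@le_trans _ _ (C * `|x - y|)); last by rewrite ler_wpM2r ?ler_norm.
  by apply: (HC (x, y)); split; rewrite /= in_itv.
have e_var t : mean P (fun w => eps t w ^+ 2) = g 0.
  by rewrite -[0](subrr t) /g -epsM.
have autocov_q l : consistent P (fun T w => autocov_hat_nat T (Y T w) (q T) l) (2 * g l).
  have [K' K'0 HK'] := g_geo.
  apply: (consistent_autocov_hat L2e e_var K0 HK gN C0 m_lip ler01 (lag_le_sqrt q_sqrt)).
  exact: (diff_autocov_large_lag l rho01 K'0 gN HK' q_oo (geometric_le_rate rho01 q_log)).
have fixed_lag (r : nat) : \forall T \near \oo, r%:R <= r%:R * Num.sqrt (T%:R : R).
  near=> T; rewrite ler_peMr// -[leLHS]sqrtr1 ler_wsqrtr// ler1n.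
  by near: T; exact: nbhs_infty_gt.
have autocov_fixed (r l : nat) : (0 < r)%N ->
    consistent P (fun T w => autocov_hat_nat T (Y T w) r l) (diff_autocov g r l).
  move=> _; apply: (consistent_autocov_hat L2e e_var K0 HK gN C0 m_lip
    (r := fun=> r) (ler0n R r) (fixed_lag r) (K' := 0)).
  by apply: nearW => T; rewrite subrr normr0 mul0r.
have cross_fixed (k l : nat) : (k <= p)%N -> (l <= p)%N ->
    consistent P (fun T w => T%:R^-1 * \sum_(p + 2 <= t < T.+1)
      lag_diff (Y T w) 1 (t - k) * lag_diff (Y T w) 1 (t - l)) (diff_autocov g 1 (k%:Z - l%:Z)).
  move=> kp lp.
  apply: (consistent_cross_sum L2e e_var K0 HK C0 m_lip (r := fun=> 1%N)
    (s := fun=> (p + 2)%N) (c := p.+1) (K' := 0) ler01).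
  - exact: (fixed_lag 1%N).
  - by apply: nearW => T; lia.
  - by apply: nearW => T; rewrite subrr normr0 mul0r.
have uG := autocov_unitmx eta_iid eta_mean eta_var eta_fourth eps_stationary
  eps_ar a_causal rho01 rho_geo nu2_gt0.
have uGr r := diff_autocov_unitmx eta_iid eta_mean eta_var eta_fourth eps_stationary
  eps_ar a_causal rho01 rho_geo nu2_gt0 (r := r).
split.
- exact/bigO_p_of_consistent_mx/(consistent_a_pilot gN g_yw autocov_q uG).
- exact/bigO_p_of_consistent_mx/(consistent_a_hat gN g_yw autocov_q autocov_fixed
    cross_fixed uG uGr rbar_ge1).
- rewrite (long_run_varianceE eta_iid eta_mean eta_var eta_fourth eps_stationary
    eps_ar a_causal rho01 rho_geo).
  exact: (consistent_sigma2_hat gN g_yw autocov_q autocov_fixed cross_fixed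
    uG uGr A1 rbar_ge1).2.
Unshelve. all: by end_near. Qed.
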